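(* Let $T$ be a complete first-order theory. (1) If $T$ has dependent dividing, then $T$ is $\mathrm{NTP}_2$. (2) If $T$ has simple dividing, then $T$ is simple.
   Context: We work in a monster model of $T$. A formula $\phi(x,y)$ has $\mathrm{TP}_2$ if there is an array $(a_{\alpha,i})_{\alpha,i<\omega}$ such that $\{\phi(x,a_{\alpha,i})\}_{i<\omega}$ is $2$-inconsistent for every $\alpha$ and $\{\phi(x,a_{\alpha,f(\alpha)})\}_{\alpha<\omega}$ is consistent for every $f:\omega\to\omega$; $T$ is $\mathrm{NTP}_2$ if no formula has $\mathrm{TP}_2$. A formula $\phi(x,y)$ has the tree property if there are $(a_\eta)_{\eta\in\omega^{<\omega}}$ and $k<\omega$ such that $\{\phi(x,a_{\eta\frown i})\}_{i<\omega}$ is $k$-inconsistent for every $\eta\in\omega^{<\omega}$ and $\{\phi(x,a_{\eta|i})\}_{i<\omega}$ is consistent for every $\eta\in\omega^\omega$. A formula is simple if it does not have the tree property, and $T$ is simple if every formula is. A formula is dependent (equivalently NIP) if it does not have the independence property. $T$ has dependent dividing if, whenever $M\preceq N$ are models and $p(x)\in S(N)$ divides over $M$, there are a dependent formula $\phi(x,y)$ and $c\in N$ such that $\phi(x,c)\in p$ and $\phi(x,c)$ divides over $M$. $T$ has simple dividing if, whenever $M\preceq N$ are models and $p(x)\in S(N)$ divides over $M$, there are a simple formula $\phi(x,y)$ and $c\in N$ such that $\phi(x,c)\in p$ and $\phi(x,c)$ divides over $M$. *)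

(* Defs.v *)
(* Classical first-order model theory over MathComp and the classical sets and
   cardinals of mathcomp.classical. *)
From mathcomp Require Import all_boot.
From mathcomp Require Import boolp classical_sets functions cardinality.

Set Implicit Arguments.
Unset Strict Implicit.
Unset Printing Implicit Defensive.

Local Open Scope classical_set_scope.
Local Open Scope card_scope.

(** * First-order logic with equality *)

Record language := Language {
  func : nat -> Type;
  rel_symb : nat -> Type }.

Inductive term (L : language) (V : Type) : Type :=
| Var of V
| App n of func L n & ('I_n -> term L V).

(* [formula L V]: formulas with free variables in [V]. The body of a quantifier
   has the additional variable [None]; the old variables become [Some _]. *)
Inductive formula (L : language) (V : Type) : Type :=
| Bot
| Eq of term L V & term L V
| Rel n of rel_symb L n & ('I_n -> term L V)
| Imp of formula L V & formula L V
| All of formula L (option V).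

Arguments Bot {L V}.

Definition Not L (V : Type) (phi : formula L V) : formula L V := Imp phi Bot.

Record structure (L : language) := Structure {
  carrier :> Type;
  carrier_inh : inhabited carrier;
  func_interp : forall n, func L n -> ('I_n -> carrier) -> carrier;
  rel_interp : forall n, rel_symb L n -> ('I_n -> carrier) -> Prop }.

Fixpoint eval L (M : structure L) (V : Type) (v : V -> M) (t : term L V) : M :=
  match t with
  | Var x => v x
  | App n f ts => func_interp f (fun i => eval v (ts i))
  end.

Fixpoint sat L (M : structure L) (V : Type) (phi : formula L V) :
    (V -> M) -> Prop :=
  match phi with
  | Bot => fun=> False
  | Eq t1 t2 => fun v => eval v t1 = eval v t2
  | Rel n r ts => fun v => rel_interp r (fun i => eval v (ts i))
  | Imp phi1 phi2 => fun v => sat phi1 v -> sat phi2 v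
  | All phi1 => fun v => forall a : M, sat phi1 (fun o => oapp v a o)
  end.

Definition sentence L := formula L void.

Definition holds_in L (M : structure L) (sigma : sentence L) : Prop :=
  sat sigma (of_void M).

Definition theory L := set (sentence L).

Definition model_of L (T : theory L) (M : structure L) : Prop :=
  forall sigma, T sigma -> holds_in M sigma.

Definition entails L (T : theory L) (sigma : sentence L) : Prop :=
  forall M : structure L, model_of T M -> holds_in M sigma.

Definition complete_theory L (T : theory L) : Prop :=
  (exists M : structure L, model_of T M) /\
  (forall sigma, entails T sigma \/ entails T (Not sigma)).

(** * Elementary substructures and automorphisms *)

Definition closed_under_funcs L (U : structure L) (A : set U) : Prop :=
  forall n (f : func L n) (xs : 'I_n -> U),
    (forall i, A (xs i)) -> A (func_interp f xs).

Definition substructure L (U : structure L) (A : set U)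
    (A0 : inhabited {x : U | A x}) (Acl : closed_under_funcs A) : structure L :=
  Structure A0
    (fun n f xs => exist A (func_interp f (fun i => sval (xs i)))
                     (Acl n f _ (fun i => svalP (xs i))))
    (fun n r xs => rel_interp r (fun i => sval (xs i))).

Definition elementary_substructure L (U : structure L) (A : set U) : Prop :=
  exists (A0 : inhabited {x : U | A x}) (Acl : closed_under_funcs A),
    forall n (phi : formula L 'I_n) (v : 'I_n -> substructure A0 Acl),
      sat phi v <-> sat (M := U) phi (fun i => sval (v i)).

Definition partial_elementary L (U : structure L)
    (A : set U) (g : U -> U) : Prop :=
  forall n (phi : formula L 'I_n) (a : 'I_n -> U), (forall i, A (a i)) ->
    (sat phi a <-> sat phi (fun i => g (a i))).

Definition automorphism L (U : structure L) (s : U -> U) : Prop :=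
  [/\ bijective s,
      forall n (f : func L n) xs,
        s (func_interp f xs) = func_interp f (fun i => s (xs i)) &
      forall n (r : rel_symb L n) xs,
        rel_interp r xs <-> rel_interp r (fun i => s (xs i))].

(** * Formulas with parameters *)

(* [phi(x,y)], with [x] an [n]-tuple and [y] an [m]-tuple of variables, is an
   element of [formula L ('I_n + 'I_m)]. *)
Definition sat2 L (U : structure L) n m (phi : formula L ('I_n + 'I_m))
    (b : 'I_n -> U) (c : 'I_m -> U) : Prop :=
  sat phi (fun z => match z with inl i => b i | inr j => c j end).

(* A formula [phi(x,c)] over [U] in the [n]-tuple of variables [x]. *)
Record pformula L (U : structure L) (n : nat) := Inst {
  pf_arity : nat;
  pf_formula : formula L ('I_n + 'I_pf_arity);
  pf_params : 'I_pf_arity -> U }.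

Arguments Inst {L U n pf_arity}.
Arguments pf_params {L U n}.

Definition psat L (U : structure L)
    n (b : 'I_n -> U) (theta : pformula U n) : Prop :=
  sat2 (pf_formula theta) b (pf_params theta).

Definition over L (U : structure L)
    n (A : set U) (theta : pformula U n) : Prop :=
  forall i, A (pf_params theta i).

Definition pnot L (U : structure L) n (theta : pformula U n) : pformula U n :=
  Inst (Not (pf_formula theta)) (pf_params theta).

Definition consistent L (U : structure L) n (Phi : set (pformula U n)) : Prop :=
  forall S : set (pformula U n), finite_set S -> S `<=` Phi ->
    exists b : 'I_n -> U, S `<=` psat b.

(* Inconsistency is that of [k] distinct indices, as usual for families. *)
Definition k_inconsistent L (U : structure L)
    (k : nat) n (F : nat -> pformula U n) : Prop :=
  forall g : 'I_k -> nat, injective g ->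
    ~ consistent (range (fun i => F (g i))).

Definition complete_type L (U : structure L)
    (A : set U) n (p : set (pformula U n)) : Prop :=
  [/\ p `<=` over A, consistent p &
      forall theta, over A theta -> p theta \/ p (pnot theta)].

Definition same_type L (U : structure L)
    (A : set U) m (c c' : 'I_m -> U) : Prop :=
  forall theta : pformula U m, over A theta -> (psat c theta <-> psat c' theta).

(** * Monster models *)

Definition card_lt X Y (A : set X) (B : set Y) : Prop :=
  A #<= B /\ ~ (B #<= A).

(* The cardinal [kappa] is that of the type [K]. *)
Definition small (K : Type) X (A : set X) : Prop := card_lt A [set: K].

Definition strong_limit (K : Type) : Prop :=
  forall A : set K, small K A -> small K [set B : set K | B `<=` A].

Definition saturated (K : Type) L (U : structure L) : Prop :=
  forall (A : set U) n (Phi : set (pformula U n)),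
    small K A -> Phi `<=` over A -> consistent Phi ->
    exists b : 'I_n -> U, Phi `<=` psat b.

Definition strongly_homogeneous (K : Type) L (U : structure L) : Prop :=
  forall (A : set U) (g : U -> U),
    small K A -> partial_elementary A g ->
    exists s : U -> U, automorphism s /\ (forall a, A a -> s a = g a).

(* [small K [set: formula L nat]] says that [|T| < kappa], where [|T|] is the
   number of formulas of the language. *)
Definition monster (K : Type) L (T : theory L) (U : structure L) : Prop :=
  [/\ strong_limit K, small K [set: formula L nat], model_of T U,
      saturated K U & strongly_homogeneous K U].

(** * Tree properties and the independence property *)

Definition has_TP2 L (U : structure L)
    n m (phi : formula L ('I_n + 'I_m)) : Prop :=
  exists a : nat -> nat -> 'I_m -> U,
    (forall alpha, k_inconsistent 2 (fun i => Inst phi (a alpha i))) /\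
    (forall f : nat -> nat,
       consistent (range (fun alpha => Inst phi (a alpha (f alpha))))).

Definition NTP2 L (U : structure L) : Prop :=
  forall n m (phi : formula L ('I_n + 'I_m)), ~ has_TP2 U phi.

(* Nodes of the tree are finite sequences [eta]; the restriction [eta|i] of
   [eta : nat -> nat] is [mkseq eta i]. *)
Definition has_tree_property L (U : structure L)
    n m (phi : formula L ('I_n + 'I_m)) : Prop :=
  exists (a : seq nat -> 'I_m -> U) (k : nat),
    (forall eta : seq nat,
       k_inconsistent k (fun i => Inst phi (a (rcons eta i)))) /\
    (forall eta : nat -> nat,
       consistent (range (fun i => Inst phi (a (mkseq eta i))))).

Definition simple_formula L (U : structure L)
    n m (phi : formula L ('I_n + 'I_m)) : Prop :=
  ~ has_tree_property U phi.

Definition simple_theory L (U : structure L) : Prop :=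
  forall n m (phi : formula L ('I_n + 'I_m)), simple_formula U phi.

Definition has_independence_property L (U : structure L)
    n m (phi : formula L ('I_n + 'I_m)) : Prop :=
  exists (a : nat -> 'I_n -> U) (b : set nat -> 'I_m -> U),
    forall i (s : set nat), sat2 phi (a i) (b s) <-> s i.

Definition dependent_formula L (U : structure L)
    n m (phi : formula L ('I_n + 'I_m)) : Prop :=
  ~ has_independence_property U phi.

(** * Dividing *)

Definition divides L (U : structure L)
    (A : set U) n (theta : pformula U n) : Prop :=
  exists (k : nat) (c : nat -> 'I_(pf_arity theta) -> U),
    (forall i, same_type A (c i) (pf_params theta)) /\
    k_inconsistent k (fun i => Inst (pf_formula theta) (c i)).

(* Implication is computed in the monster model, where it agrees with
   [p |- theta] for [p] over a small set. *)
Definition type_divides L (U : structure L)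
    (A : set U) n (p : set (pformula U n)) : Prop :=
  exists theta : pformula U n,
    (forall b : 'I_n -> U, p `<=` psat b -> psat b theta) /\ divides A theta.

Definition small_model L (U : structure L) (K : Type) (M : set U) : Prop :=
  small K M /\ elementary_substructure M.

(* For [M] and [N] elementary in [U], [M] is elementary in [N] iff [M] is
   included in [N]. *)
Definition dependent_dividing L (U : structure L) (K : Type) : Prop :=
  forall (M N : set U), small_model K M -> small_model K N -> M `<=` N ->
  forall n (p : set (pformula U n)), complete_type N p -> type_divides M p ->
  exists m (phi : formula L ('I_n + 'I_m)) (c : 'I_m -> U),
    [/\ dependent_formula U phi, forall j, N (c j), p (Inst phi c) &
        divides M (Inst phi c)].

Definition simple_dividing L (U : structure L) (K : Type) : Prop :=
  forall (M N : set U), small_model K M -> small_model K N -> M `<=` N ->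
  forall n (p : set (pformula U n)), complete_type N p -> type_divides M p ->
  exists m (phi : formula L ('I_n + 'I_m)) (c : 'I_m -> U),
    [/\ simple_formula U phi, forall j, N (c j), p (Inst phi c) &
        divides M (Inst phi c)].

(* Main.v *)
(** (2) Stretch the tree along a well-order [X] with more elements than there
    are formulas, inside Skolem hulls: this gives [b_x], increasing models
    [M_x] containing [b_y] for [y < x], and a point [a] with [phi(a, b_x)]
    for all [x], where [phi(x, b_x)] divides over [M_x]. Simple dividing
    provides simple formulas [psi_x(x, c_x)] true of [a], dividing over [M_x],
    with [c_x] in the next model. By cardinality the same [psi] and the same
    number of inconsistency occur infinitely often; the resulting dividing
    chain, unfolded by automorphisms, is a tree for [psi].

    (1) Let [a_(al,i)] be a [TP2] array in a countably saturated model [M] and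
    [G] an ultrafilter on [nat * nat] whose members all contain infinitely many
    points of some row, but containing the complement of each row. The limit
    type [q] of the [a_t] along [G] has [phi]-consistent Morley sequences, since
    generic indices lie in different rows, yet for [b] realizing [q] the formula
    [phi(x, b)] divides over [M], since it is possible to choose realizations
    imitating a single row. Take for [N] the ultrapower of [M] along [G].
    Dependent dividing and compactness give
    [phi(x, b) |- \/_l psi_l(x, c_l)], each [psi_l] dependent and [psi_l(x, c_l)]
    dividing over [M], and [c_l] realizes the limit of a family [F_l t] of tuples
    of [M]. By pigeonhole some [psi_l] is consistent along the Morley sequence of
    the limit [q_l] of [F_l]. As [M] is countably saturated, [q_l] is an heir of
    its restriction to [M], hence dividing persists over every larger set;
    successive choices produce arrays of any finite height with inconsistent
    rows and consistent paths. Counting extracts from them finite configurations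
    shattered by [psi_l], so that [psi_l] is not dependent. *)
From mathcomp Require Import all_boot.
From mathcomp Require Import boolp classical_sets functions cardinality filter.
From mathcomp Require wochoice.
From Stdlib Require List.
Require Import Defs.

Set Implicit Arguments.
Unset Strict Implicit.
Unset Printing Implicit Defensive.

Local Open Scope classical_set_scope.
Local Open Scope card_scope.

(** * Formulas *)

Fixpoint trename L (V W : Type) (f : V -> W) (t : term L V) : term L W :=
  match t with
  | Var x => Var L (f x)
  | App n g ts => App g (fun i => trename f (ts i))
  end.

Fixpoint rename L (V : Type) (phi : formula L V) : forall W : Type, (V -> W) -> formula L W :=
  match phi with
  | Bot => fun W f => Bot
  | Eq t1 t2 => fun W f => Eq (trename f t1) (trename f t2)
  | Rel n r ts => fun W f => Rel r (fun i => trename f (ts i))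
  | Imp phi1 phi2 => fun W f => Imp (rename phi1 f) (rename phi2 f)
  | All phi1 => fun W f => All (rename phi1 (omap f))
  end.

Definition Conj L (V : Type) (phi psi : formula L V) := Not (Imp phi (Not psi)).
Definition Ex L (V : Type) (phi : formula L (option V)) := Not (All (Not phi)).
Definition Conjs L (V : Type) (s : seq (formula L V)) := foldr (@Conj L V) (Not Bot) s.

Definition sumv (V1 V2 T : Type) (w : V1 -> T) (v : V2 -> T) (z : V1 + V2) : T :=
  match z with inl x => w x | inr y => v y end.

Lemma eval_trename L (M : structure L) (V W : Type) (f : V -> W) (t : term L V) (v : W -> M) :
  eval v (trename f t) = eval (v \o f) t.
Proof.
elim: t => //= n g ts IH. congr (func_interp _ _). apply/funext => i; exact: IH.
Qed.

Lemma sat_rename L (M : structure L) (V : Type) (phi : formula L V) :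
  forall (W : Type) (f : V -> W) (v : W -> M), sat (rename phi f) v = sat phi (v \o f).
Proof.
elim: phi => {V} [V|V t1 t2|V n r ts|V p IHp q IHq|V p IHp] W f v //=.
- by rewrite !eval_trename.
- by congr (rel_interp _ _); apply/funext => i; rewrite eval_trename.
- by rewrite IHp IHq.
- apply: eq_forall => a; rewrite IHp; congr sat.
  by apply/funext => -[].
Qed.

Lemma sat_Not L (M : structure L) (V : Type) (phi : formula L V) (v : V -> M) :
  sat (Not phi) v = ~ sat phi v.
Proof. by []. Qed.

Lemma sat_Conj L (M : structure L) (V : Type) (phi psi : formula L V) (v : V -> M) :
  sat (Conj phi psi) v = (sat phi v /\ sat psi v).
Proof.
apply: propext; split=> /= [H|[h1 h2]]; last by apply.
by split; apply: contrapT => h; apply: H.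
Qed.

Lemma sat_Ex L (M : structure L) (V : Type) (phi : formula L (option V)) (v : V -> M) :
  sat (Ex phi) v = exists a : M, sat phi (oapp v a).
Proof.
apply: propext; split=> /= [H|[a h] /(_ a)] //.
by apply: contrapT => h; apply: H => a pa; apply: h; exists a.
Qed.

Lemma sat_Conjs L (M : structure L) (V : Type) (s : seq (formula L V)) (v : V -> M) :
  sat (Conjs s) v = forall phi, List.In phi s -> sat phi v.
Proof.
elim: s => [|phi s IH]; first by apply: propext; split=> //= _ [].
rewrite [Conjs _]/(Conj phi (Conjs s)) sat_Conj IH; apply: propext; split=> [[h1 h2] psi /= [<-//|]|H].
  exact: h2.
by split=> [|psi hpsi]; apply: H; [left|right].
Qed.

Lemma In_mem (T : eqType) (x : T) (s : seq T) : List.In x s <-> x \in s.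
Proof.
elim: s => //= y s IH; rewrite inE; split=> [[->|/IH->]|/orP[/eqP->|/IH]].
- by rewrite eqxx.
- by rewrite orbT.
- by left.
- by right.
Qed.

Lemma In_bigmax (i : nat) (s : seq nat) : List.In i s -> i <= \max_(j <- s) j.
Proof. by move/In_mem => h; apply: (leq_bigmax_seq (F := id)). Qed.

Lemma In_enum (I : finType) (i : I) : List.In i (enum I).
Proof. by apply/In_mem; rewrite mem_enum. Qed.

Lemma sat_Conjs_map L (M : structure L) (V : Type) (I : finType) (f : I -> formula L V) (v : V -> M) :
  sat (Conjs (List.map f (enum I))) v = forall i, sat (f i) v.
Proof.
rewrite sat_Conjs; apply: propext; split=> [H i|H phi /List.in_map_iff[i [<- _]]//].
by apply/H/List.in_map/In_enum.
Qed.

Lemma eval_support L (V : Type) (t : term L V) : exists s : seq V,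
  forall (M : structure L) (v v' : V -> M),
    (forall x, List.In x s -> v x = v' x) -> eval v t = eval v' t.
Proof.
elim: t => [x|n g ts /choice[s hs]].
  by exists [:: x] => M v v' /= h; apply: h; left.
exists (List.flat_map s (enum 'I_n)) => M v v' h /=; congr (func_interp _ _).
apply/funext => i; apply: hs => x hx; apply: h.
by apply/List.in_flat_map; exists i; split => //; apply: In_enum.
Qed.

Lemma sat_support L (V : Type) (phi : formula L V) : exists s : seq V,
  forall (M : structure L) (v v' : V -> M),
    (forall x, List.In x s -> v x = v' x) -> sat phi v = sat phi v'.
Proof.
elim: phi => {V} [V|V t1 t2|V n r ts|V p [s1 IHp] q [s2 IHq]|V p [s IH]].
- by exists [::].
- have [s1 h1] := eval_support t1; have [s2 h2] := eval_support t2.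
  exists (s1 ++ s2) => M v v' h /=.
  by congr (_ = _); [apply: h1|apply: h2] => x hx; apply: h; apply/List.in_app_iff; [left|right].
- have /choice[s hs] := fun i => eval_support (ts i).
  exists (List.flat_map s (enum 'I_n)) => M v v' h /=; congr (rel_interp _ _).
  apply/funext => i; apply: hs => x hx; apply: h.
  by apply/List.in_flat_map; exists i; split => //; apply: In_enum.
- exists (s1 ++ s2) => M v v' h /=.
  rewrite (IHp _ v v') ?(IHq _ v v') // => x hx; apply: h; apply/List.in_app_iff; by [left|right].
- exists (pmap id s) => M v v' h /=; apply: eq_forall => a; apply: IH => -[x|//] hx /=.
  apply: h; elim: s hx => //= -[y|] s IHs [|] //.
  + by move=> [->]; left.
  + by move=> /IHs; right.
Qed.

Lemma ex_closure L (V1 V2 : Type) (phi : formula L (V1 + V2)) : exists chi : formula L V2,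
  forall (M : structure L) (v : V2 -> M),
    sat chi v = exists w : V1 -> M, sat phi (sumv w v).
Proof.
have [s0 hs0] := sat_support phi.
have : exists s : seq V1, forall (M : structure L) (v : V2 -> M) (w w' : V1 -> M),
    (forall x, List.In x s -> w x = w' x) -> sat phi (sumv w v) = sat phi (sumv w' v).
  exists (List.flat_map (fun z => match z with inl x => [:: x] | inr _ => [::] end) s0).
  move=> M v w w' h; apply: hs0 => -[x|//] hx /=; apply: h.
  by apply/List.in_flat_map; exists (inl x); split=> //; left.
move=> {s0 hs0} [s]; elim: s phi => [|x s IH] phi hs.
  pose r (z : V1 + V2) : option V2 := match z with inl _ => None | inr y => Some y end.
  exists (Ex (rename phi r)) => M v; rewrite sat_Ex; apply: propext; split=> [[a]|[w hw]].
    rewrite sat_rename => h; exists (fun=> a); move: h; congr sat.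
    by apply/funext => -[].
  have [a] := carrier_inh M; exists a; rewrite sat_rename.
  rewrite (_ : _ \o _ = sumv (fun=> a) v); last by apply/funext => -[].
  by rewrite (hs _ _ _ w).
pose r (z : V1 + V2) : option (V1 + V2) :=
  if `[< z = inl x >] then None else Some z.
have satr (M : structure L) v (w : V1 -> M) : sat (Ex (rename phi r)) (sumv w v) =
    exists a, sat phi (sumv (fun y => if `[< y = x >] then a else w y) v).
  rewrite sat_Ex; apply: eq_exists => a; rewrite sat_rename; congr sat.
  apply/funext => -[y|y]; rewrite /r /=; last by rewrite asboolF.
  by case: asboolP => [[->]|h]; [rewrite asboolT|rewrite asboolF// => e; apply: h; rewrite e].
have [chi hchi] : exists chi : formula L V2, forall (M : structure L) (v : V2 -> M),
    sat chi v = exists w, sat (Ex (rename phi r)) (sumv w v).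
  apply: IH => M v w w' h; rewrite !satr; apply: eq_exists => a.
  apply: hs => y /= [->|hy]; first by rewrite !asboolT.
  by case: asboolP => // _; apply: h.
exists chi => M v; rewrite hchi; apply: propext; split=> [[w]|[w hw]].
  by rewrite satr => -[a ha]; exists (fun y => if `[< y = x >] then a else w y).
exists w; rewrite satr; exists (w x); move: hw; congr sat; congr sumv.
by apply/funext => y; case: asboolP => // ->.
Qed.

(** * Small index types *)

Lemma card_leT_inj (T S : Type) (B : set S) :
  [set: T] #<= B -> exists f : T -> S, injective f /\ forall x, B (f x).
Proof.
move=> /card_leP[f]; exists (fun x => val (f (to_setT x))); split; last first.
  by move=> x; have := valP (f (to_setT x)); rewrite inE.
move=> x y /val_inj e.
have h (z : T) : to_setT z \in [set: [set: T]] by rewrite inE.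
by have /(congr1 val) := inj (h x) (h y) e.
Qed.

Lemma finite_set_In (T : Type) (A : set T) :
  finite_set A -> exists s : seq T, forall x, A x <-> List.In x s.
Proof.
move=> /(@finite_seqP {classic T})[s ->]; by exists s => x; rewrite (@In_mem {classic T}).
Qed.

Lemma finite_set_of_seq (T : Type) (s : seq T) : finite_set [set x | List.In x s].
Proof.
elim: s => [|y s IH]; first by rewrite (_ : [set _ | _] = set0) // -subset0.
by rewrite (_ : [set _ | _] = [set y] `|` [set x | List.In x s]) ?finite_setU //;
  apply/seteqP; split=> x /= [->|]; by [left|right].
Qed.

Lemma sval_inj (T : Type) (A : set T) : injective (@sval T A).
Proof. by move=> [x Ax] [y Ay] /= e; apply: eq_exist. Qed.

(* At most [2 ^ |T|] elements. As [kappa] is a strong limit above [|T|], a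
   family indexed by such a type has a small range. *)
Definition tiny L (T : Type) := exists f : T -> set (formula L nat), injective f.

Lemma tiny_inj L (T S : Type) (f : T -> S) : injective f -> tiny L S -> tiny L T.
Proof. by move=> fi [c ci]; exists (c \o f); apply: inj_comp. Qed.

Definition numeral L n : formula L nat := iter n (Imp Bot) Bot.

Lemma numeral_inj L : injective (@numeral L).
Proof. by elim=> [|n IH] [|m] //= [] /IH ->. Qed.

Lemma tiny_fun L (T : Type) : tiny L T -> tiny L (nat -> T).
Proof.
move=> [c ci].
exists (fun f psi => exists n phi, psi = Imp (numeral L n) phi /\ c (f n) phi).
move=> f g e; apply/funext => n; apply: ci; apply/seteqP; split=> phi h.
  have : exists m phi', Imp (numeral L n) phi = Imp (numeral L m) phi' /\ c (f m) phi'.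
    by exists n, phi.
  by rewrite [exists _, _](congr1 (@^~ _) e) => -[m [phi' [[/numeral_inj -> ->]]]].
have : exists m phi', Imp (numeral L n) phi = Imp (numeral L m) phi' /\ c (g m) phi'.
  by exists n, phi.
by rewrite -[exists _, _](congr1 (@^~ _) e) => -[m [phi' [[/numeral_inj -> ->]]]].
Qed.

Lemma tiny_count L (I : countType) : tiny L I.
Proof.
exists (fun i => [set numeral L (pickle i)]) => i j e.
have : [set numeral L (pickle i)] (numeral L (pickle i)) by [].
by rewrite e => /numeral_inj /(congr1 (@unpickle I)); rewrite !pickleK => -[].
Qed.

Lemma tiny_formula L : tiny L (formula L nat).
Proof.
exists set1 => p q e; have : [set p] p by [].
by rewrite e.
Qed.

Lemma tiny_set_formula L : tiny L (set (formula L nat)).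
Proof. by exists id. Qed.

Lemma tiny_prod L (T S : Type) : tiny L T -> tiny L S -> tiny L (T * S).
Proof.
move=> [c ci] [d di]; have := tiny_fun (tiny_set_formula L).
apply: (tiny_inj (f := fun z n => if n is 0 then c z.1 else d z.2)).
move=> [x y] [x' y'] e.
by have /= /ci -> := congr1 (@^~ 0) e; have /= /di -> := congr1 (@^~ 1) e.
Qed.

Lemma tiny_sum L (T S : Type) : tiny L T -> tiny L S -> tiny L (T + S).
Proof.
move=> [c ci] [d di].
have := tiny_prod (tiny_count L bool) (tiny_set_formula L).
apply: (tiny_inj (f := fun z => match z with inl x => (true, c x) | inr y => (false, d y) end)).
by move=> [x|x] [y|y] [] // => [/ci|/di] ->.
Qed.

Lemma tiny_option L (T : Type) : tiny L T -> tiny L (option T).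
Proof.
move=> h; have := tiny_sum (tiny_count L unit) h.
apply: (tiny_inj (f := fun z => if z is Some x then inr x else inl tt)).
by move=> [x|] [y|] // [->].
Qed.

Lemma tiny_count_fun L (I : countType) (T : Type) : tiny L T -> tiny L (I -> T).
Proof.
move=> /tiny_option/tiny_fun.
apply: (tiny_inj (f := fun f n => omap f (@unpickle I n))) => f g e.
by apply/funext => i; have /= := congr1 (@^~ (pickle i)) e; rewrite pickleK => -[].
Qed.

Lemma tiny_sig L (T S : Type) (f : T -> S) (A : set S) :
  (forall y, A y -> exists x, f x = y) -> tiny L T -> tiny L {y | A y}.
Proof.
move=> h; have /choice[g hg] : forall y : {y | A y}, exists x, f x = sval y.
  by move=> [y Ay]; exact: h.
by apply: (tiny_inj (f := g)) => y y' e; apply: sval_inj; rewrite -hg e hg.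
Qed.

Inductive wtree (A B : Type) :=
| Leaf of A
| Node of B & (nat -> wtree A B).
Arguments Leaf {A B}.

Fixpoint wlabel (A B : Type) (t : wtree A B) (s : seq nat) : option (A + B) :=
  match t, s with
  | Leaf a, [::] => Some (inl a)
  | Leaf a, _ :: _ => None
  | Node b _, [::] => Some (inr b)
  | Node _ ts, i :: s => wlabel (ts i) s
  end.

Lemma tiny_wtree L (A B : Type) : tiny L A -> tiny L B -> tiny L (wtree A B).
Proof.
move=> hA hB.
have := tiny_count_fun (seq nat) (tiny_option (tiny_sum hA hB)).
apply: (tiny_inj (f := @wlabel A B)).
elim=> [a|b ts IH] [a'|b' ts'] e; have //= [] := congr1 (@^~ [::]) e; first by move=> ->.
move=> ->; congr Node; apply/funext => i; apply: IH.
by apply/funext => s; have := congr1 (@^~ (i :: s)) e.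
Qed.

Lemma small_le (K X Y : Type) (A : set X) (B : set Y) : A #<= B -> small K B -> small K A.
Proof.
move=> AB [BK KB]; split; first exact: card_le_trans BK.
by move=> KA; apply: KB; apply: card_le_trans KA AB.
Qed.

Lemma small_range L (K T X : Type) (f : T -> X) : strong_limit K ->
  small K [set: formula L nat] -> tiny L T -> small K (range f).
Proof.
move=> sl sF [c ci]; have [FK _] := sF.
have [i [ii _]] := card_leT_inj FK.
have sA : small K (range i) by apply: small_le sF; exact: card_image_le.
apply: small_le (sl _ sA).
have [[t0]|nT] := pselect (inhabited T); last first.
  have -> : range f = set0 by apply/seteqP; split=> // x [t _ _]; apply: nT.
  exact: card_ge0.
have /choice[g hg] : forall B : set K, exists t, forall t', B = i @` c t' -> t = t'.
  move=> B; have [[t ht]|n] := pselect (exists t, B = i @` c t); last first.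
    by exists t0 => t' ht'; case: n; exists t'.
  exists t => t'; rewrite ht => e; apply: ci; apply/seteqP.
  split=> p hp.
    have : (i @` c t) (i p) by exists p.
    by rewrite e => -[q hq /ii <-].
  have : (i @` c t') (i p) by exists p.
  by rewrite -e => -[q hq /ii <-].
apply: card_le_trans (card_image_le (f \o g) _).
apply: subset_card_le => _ [t _ <-]; exists (i @` c t) => /=.
  by move=> _ [p _ <-]; exists p.
by rewrite (hg _ t).
Qed.

Lemma small_sub_range L (K T X : Type) (f : T -> X) (A : set X) : strong_limit K ->
  small K [set: formula L nat] -> tiny L T -> A `<=` range f -> small K A.
Proof. by move=> sl sF tT Af; apply: small_le (small_range f sl sF tT); exact: subset_card_le. Qed.

(** * Saturation and homogeneity *)

Lemma consistentP L (U : structure L) n (Phi : set (pformula U n)) :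
  consistent Phi <-> forall s, (forall theta, List.In theta s -> Phi theta) ->
    exists b, forall theta, List.In theta s -> psat b theta.
Proof.
split=> [H s hs|H S fS SPhi]; first exact: H _ (finite_set_of_seq s) hs.
have [s hs] := finite_set_In fS; have [|b hb] := H s.
  by move=> theta /hs /SPhi.
by exists b => theta /hs /hb.
Qed.

Lemma saturation K L (T : theory L) (U : structure L) (hU : monster K T U)
    (V : Type) (g : V -> U) n (Phi : set (pformula U n)) : tiny L V ->
  Phi `<=` over (range g) -> consistent Phi -> exists b, Phi `<=` psat b.
Proof.
by case: hU => sl sF _ sat _ tV; apply: sat; exact: small_range sl sF tV.
Qed.

Lemma In_tnth (T : Type) (l : seq T) (z : T) :
  List.In z l <-> exists i, tnth (in_tuple l) i = z.
Proof.
elim: l => [|y l IH] /=; first by split=> // -[[]].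
split=> [[<-|/IH[i <-]]|[i]].
- by exists ord0.
- by exists (lift ord0 i); rewrite !(tnth_nth z).
- rewrite (tnth_nth z); case: i => -[|i] /= hi e; first by left.
  right; apply/IH; rewrite ltnS in hi; exists (Ordinal hi).
  by rewrite (tnth_nth z).
Qed.

(* [l] is a finite approximation of a partial assignment and [s] of [Phi]. *)
Definition realizes L (U : structure L) (V : Type) (s : seq (formula L V))
    (l : seq (V * U)) (v : V -> U) : Prop :=
  (forall phi, List.In phi s -> sat phi v) /\ (forall z, List.In z l -> v z.1 = z.2).

Lemma realizes_formula L (U : structure L) (V : Type) (s : seq (formula L V))
    (l : seq (V * U)) (x : V) : exists theta : pformula U 1,
  over [set u | exists y, List.In (y, u) l] theta /\
  forall b, psat b theta <-> exists2 v, realizes s l v & v x = b ord0.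
Proof.
pose m := size l; pose t := in_tuple l.
have [chi hchi] := ex_closure (V2 := 'I_1 + 'I_m) (Conj (Conj
  (rename (Conjs s) inl) (Eq (Var L (inl x)) (Var L (inr (inl ord0)))))
  (Conjs (List.map (fun i => Eq (Var L (inl (tnth t i).1)) (Var L (inr (inr i))))
     (enum 'I_m)))).
exists (Inst chi (fun i => (tnth t i).2)); split=> [i|b].
  exists (tnth t i).1; apply/In_tnth; exists i => /=; exact: surjective_pairing.
rewrite /psat /sat2 /= hchi; split=> -[v].
  rewrite !sat_Conj sat_Conjs_map sat_rename sat_Conjs => -[[h1 h2] h3].
  by exists v => //; split=> // z /In_tnth[i <-]; exact: h3.
move=> [h1 h2] h3; exists v.
rewrite !sat_Conj sat_Conjs_map sat_rename sat_Conjs; split=> // i /=.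
by apply: h2; apply/In_tnth; exists i.
Qed.

Lemma compactness K L (T : theory L) (U : structure L) (hU : monster K T U)
    (V : Type) (R0 : set (V * U)) (Phi : set (formula L V)) : tiny L V ->
  (forall s l, (forall phi, List.In phi s -> Phi phi) ->
    (forall z, List.In z l -> R0 z) -> exists v, realizes s l v) ->
  exists v : V -> U, (forall phi, Phi phi -> sat phi v) /\ (forall z, R0 z -> v z.1 = z.2).
Proof.
move=> tV fin.
pose good (R : set (V * U)) := forall s l, (forall phi, List.In phi s -> Phi phi) ->
  (forall z, List.In z l -> (R0 `|` R) z) -> exists v, realizes s l v.
have good0 : good set0 by rewrite /good setU0.
have [F Fgood Ftot|R [Rgood Rmax]] := @Zorn_bigcup _ good.
  move=> s l hs hl.
  have [X [FX hX]] : exists X, (F X \/ X = set0) /\ (forall z, List.In z l -> (R0 `|` X) z).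
    elim: l hl => [|z l IH] hl; first by exists set0; split; [right|].
    have [|X [FX hX]] := IH; first by move=> y hy; apply: hl; right.
    have [hz|[Y FY Yz]] := hl z (or_introl erefl).
      by exists X; split=> // y [<-|/hX//]; left.
    have [XY|YX] : X `<=` Y \/ Y `<=` X.
    - by case: FX => [FX|->]; [exact: Ftot|left].
    - exists Y; split; first by left.
      move=> y [<-|/hX[|/XY]]; by [right|left|right].
    - by exists X; split=> // y [<-|/hX//]; right; apply: YX.
  by case: FX hX => [/Fgood gX|->]; [exact: gX|exact: good0].
have Rfun x u u' : (R0 `|` R) (x, u) -> (R0 `|` R) (x, u') -> u = u'.
  move=> h h'; have [||v [_ hv]] := Rgood [::] [:: (x, u); (x, u')] => //.
    by move=> z [<-|[<-|]].
  have /= <- := hv (x, u) (or_introl erefl).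
  by have /= <- := hv (x, u') (or_intror (or_introl erefl)).
have [u0] := carrier_inh U.
have Rtot x : exists u, R (x, u).
  have /choice[g hg] : forall y, exists u, forall u', (R0 `|` R) (y, u') -> u' = u.
    move=> y; have [[u hu]|n] := pselect (exists u, (R0 `|` R) (y, u)).
      by exists u => u' hu'; exact: Rfun hu' hu.
    by exists u0 => u' hu'; case: n; exists u'.
  have Rg z : (R0 `|` R) z -> range g z.2.
    by case: z => y u /hg /= ->; exists y.
  pose Psi : set (pformula U 1) := [set theta | over (range g) theta /\
    exists s l, [/\ forall phi, List.In phi s -> Phi phi,
      forall z, List.In z l -> (R0 `|` R) z &
      forall b, psat b theta <-> exists2 v, realizes s l v & v x = b ord0]].
  have [||b hb] := @saturation _ _ _ _ hU V g _ Psi tV.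
  - by move=> theta [].
  - apply/consistentP => S hS.
    have [s [l [hs hl hsl]]] : exists s l, [/\ forall phi, List.In phi s -> Phi phi,
      forall z, List.In z l -> (R0 `|` R) z &
      forall v b, realizes s l v -> v x = b ord0 ->
        forall theta, List.In theta S -> psat b theta].
      elim: S hS => [|theta S IH] hS; first by exists [::], [::].
      have [|s [l [hs hl hsl]]] := IH; first by move=> z hz; apply: hS; right.
      have [_ [s' [l' [hs' hl' hsl']]]] := hS theta (or_introl erefl).
      exists (s' ++ s), (l' ++ l); split.
      + by move=> phi /List.in_app_iff[/hs'|/hs].
      + by move=> phi /List.in_app_iff[/hl'|/hl].
      move=> v b [h1 h2] h3 z [<-|].
        apply/hsl'; exists v => //.
        by split=> y hy; [apply: h1|apply: h2]; apply/List.in_app_iff; left.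
      apply: hsl h3 _.
      by split=> y hy; [apply: h1|apply: h2]; apply/List.in_app_iff; right.
    have [v hv] := Rgood s l hs hl.
    by exists (fun=> v x); exact: (hsl v (fun=> v x) hv erefl).
  - pose u := b ord0; exists u; apply: contrapT => nR.
    apply: (Rmax (R `|` [set (x, u)])).
      by split=> [z|H]; [left|apply: nR; apply: H; right].
    move=> s l hs hl.
    have [l' [hl' ll']] : exists l', (forall z, List.In z l' -> (R0 `|` R) z) /\
        forall z, List.In z l -> List.In z l' \/ z = (x, u).
      elim: l hl => [|z l IH] hl; first by exists [::].
      have [|l' [hl' ll']] := IH; first by move=> y hy; apply: hl; right.
      have [hz|[hz|hz]] := hl z (or_introl erefl).
      + exists (z :: l'); split=> [y [<-|/hl'//]|y [<-|/ll'[]]]; first by left.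
        * by left; left.
        * by left; right.
        * by right.
      + exists (z :: l'); split=> [y [<-|/hl'//]|y [<-|/ll'[]]]; first by right.
        * by left; left.
        * by left; right.
        * by right.
      + by exists l'; split=> // y [<-|/ll'//]; right.
    have [theta [otheta htheta]] := realizes_formula s l' x.
    have /hb /htheta[v [hv1 hv2] hv] : Psi theta.
      split; last by exists s, l'.
      by move=> i; have [y /hl' /Rg] := otheta i.
    by exists v; split=> // z /ll'[/hv2//|->].
have /choice[v hv] := Rtot.
exists v; split=> [phi Pphi|[x u] hxu]; last first.
  by apply: (Rfun x); [right; exact: hv|left].
have [s hs] := sat_support phi.
have [||v' [h1 h2]] := Rgood [:: phi] (List.map (fun x => (x, v x)) s).
- by move=> p [<-|].
- by move=> z /List.in_map_iff[x [<- _]]; right; apply: hv.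
rewrite (hs _ _ v'); first by apply: h1; left.
move=> x hx; have /= -> // := h2 (x, v x).
by apply/List.in_map_iff; exists x.
Qed.

Lemma compactness_over K L (T : theory L) (U : structure L) (hU : monster K T U)
    (V1 V2 : Type) (v : V2 -> U) (Phi : set (formula L (V1 + V2))) :
  tiny L V1 -> tiny L V2 ->
  (forall s, (forall phi, List.In phi s -> Phi phi) ->
    exists w : V1 -> U, forall phi, List.In phi s -> sat phi (sumv w v)) ->
  exists w : V1 -> U, forall phi, Phi phi -> sat phi (sumv w v).
Proof.
move=> t1 t2 H.
have [s l hs hl|w [h1 h2]] :=
    compactness (R0 := [set (inr y, v y) | y in setT]) hU (tiny_sum t1 t2) (Phi := Phi).
  have [w hw] := H s hs; exists (sumv w v); split=> // z /hl[y _ <-] //.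
exists (w \o inl) => phi /h1; congr sat.
apply/funext => -[x|y] //=.
by have /= := h2 (inr y, v y); apply; exists y.
Qed.

Lemma homogeneity K L (T : theory L) (U : structure L) (hU : monster K T U)
    (V : Type) (c d : V -> U) : tiny L V ->
  (forall phi : formula L V, sat phi c <-> sat phi d) ->
  exists s, automorphism s /\ forall i, s (c i) = d i.
Proof.
move=> tV cd; case: hU => sl sF _ _ hom.
have dd i j : c i = c j -> d i = d j.
  by move=> e; have /= := cd (Eq (Var L i) (Var L j)) => h; apply/h.
have [u0] := carrier_inh U.
have /choice[g hg] : forall u, exists u', forall i, c i = u -> d i = u'.
  move=> u; have [[i hi]|n] := pselect (exists i, c i = u).
    by exists (d i) => j hj; apply: dd; rewrite hj hi.
  by exists u0 => j hj; case: n; exists j.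
have [|s [sa hs]] := hom (range c) g (small_range c sl sF tV).
  move=> n phi a /(_ _)/cid2-/all_sig2[i _ hi].
  rewrite (_ : a = c \o i); last by apply/funext => j; rewrite /= hi.
  rewrite (_ : (fun _ => _) = d \o i); last first.
    by apply/funext => j /=; rewrite -(hg _ (i j)).
  by rewrite -(sat_rename phi i c) -(sat_rename phi i d); exact: cd.
by exists s; split=> // i; rewrite hs; [rewrite -(hg _ i)|exists i].
Qed.

Lemma eval_automorphism L (U : structure L) (s : U -> U) : automorphism s ->
  forall (V : Type) (t : term L V) v, eval (s \o v) t = s (eval v t).
Proof.
move=> [_ sf _] V; elim=> //= n f ts IH v; rewrite sf; congr (func_interp _ _).
by apply/funext => i; exact: IH.
Qed.

Lemma sat_automorphism L (U : structure L) (s : U -> U) : automorphism s ->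
  forall (V : Type) (phi : formula L V) v, sat phi (s \o v) = sat phi v.
Proof.
move=> sa V; have [[s' s's ss'] sf sr] := sa.
elim=> {V} [V|V t1 t2|V n r ts|V p IHp q IHq|V p IHp] v //=.
- rewrite !eval_automorphism //; apply: propext; split=> [/(can_inj s's)|->] //.
- have -> : (fun i => eval (s \o v) (ts i)) = (fun i => s (eval v (ts i))).
    by apply/funext => i; exact: eval_automorphism.
  by apply: propext; apply: iff_sym; exact: sr.
- by rewrite IHp IHq.
- have E a : sat p (oapp (s \o v) (s a)) = sat p (oapp v a).
    by rewrite -(IHp (oapp v a)); congr sat; apply/funext => -[].
  apply: propext; split=> h a; first by rewrite -E; apply: h.
  by rewrite -(ss' a) E; apply: h.
Qed.

Lemma sat_substructure L (U : structure L) (A : set U) (A0 : inhabited {x : U | A x})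
    (Acl : closed_under_funcs A) :
  (forall (V : Type) (chi : formula L (option V)) (v : V -> U) (u : U),
    (forall i, A (v i)) -> sat chi (oapp v u) -> exists2 u', A u' & sat chi (oapp v u')) ->
  forall (V : Type) (phi : formula L V) (v : V -> substructure A0 Acl),
    sat phi v = sat phi (fun i => sval (v i)).
Proof.
move=> tv V phi.
have ev W (t : term L W) (v : W -> substructure A0 Acl) :
    sval (eval v t) = eval (fun i => sval (v i)) t.
  elim: t => //= n f ts IH; congr (func_interp _ _); apply/funext => i; exact: IH.
elim: phi => {V} [V|V t1 t2|V n r ts|V p IHp q IHq|V p IHp] v //=.
- rewrite -!ev; apply: propext; split=> [->//|]; exact: sval_inj.
- by congr (rel_interp _ _); apply/funext => i; exact: ev.
- by rewrite IHp IHq.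
- have E a : sat p (oapp v a) = sat p (oapp (fun i => sval (v i)) (sval a)).
    by rewrite IHp; congr sat; apply/funext => -[].
  apply: propext; split=> [h a|h a]; last by rewrite E; apply: h.
  apply: contrapT => na.
  have [|u Au] := tv _ (Not p) (fun i => sval (v i)) a _ na.
    by move=> i; exact: svalP.
  by move=> /=; have := h (exist _ u Au); rewrite E.
Qed.

Lemma tarski_vaught L (U : structure L) (A : set U) :
  (exists x, A x) ->
  (forall (chi : formula L nat) (y : nat -> U) u, (forall i, A (y i)) ->
    sat chi (fun i => if i is j.+1 then y j else u) ->
    exists2 u', A u' & sat chi (fun i => if i is j.+1 then y j else u')) ->
  elementary_substructure A.
Proof.
move=> [x0 Ax0] tvn.
have tv (V : Type) (chi : formula L (option V)) (v : V -> U) u : (forall i, A (v i)) ->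
    sat chi (oapp v u) -> exists2 u', A u' & sat chi (oapp v u').
  move=> Av; have [s hs] := sat_support chi.
  pose l := pmap id s.
  pose r (o : option V) := if o is Some x then (@index {classic V} x l).+1 else 0.
  pose y i := nth x0 [seq v x | x <- l] i.
  have E a : sat chi (oapp v a) = sat (rename chi r) (fun i => if i is j.+1 then y j else a).
    rewrite sat_rename; apply: hs => -[x|//] hx /=.
    have hx' : (x : {classic V}) \in (l : seq {classic V}).
      rewrite /l {l r y}; elim: s hx => //= -[z|] s IH [|] //.
      + by move=> [->]; rewrite inE eqxx.
      + by move=> /IH; rewrite inE orbC => ->.
    by rewrite /y (@nth_map {classic V} x) ?index_mem // nth_index.
  rewrite E => /tvn[|u' Au' hu']; last by exists u' => //; rewrite E.
  move=> i; rewrite /y; have [hi|hi] := ltnP i (size l); last by rewrite nth_default // size_map.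
  have [z] : exists z : V, True by move: hi; case: (l) => // z *; exists z.
  by rewrite (nth_map z).
have Acl : closed_under_funcs A.
  move=> n f xs Axs.
  have [//||u' Au'] := tv _ (Eq (Var L None) (App f (fun i => Var L (Some i)))) xs (func_interp f xs) => //.
  by move=> /= <-.
have A0 : inhabited {x | A x} by split; exists x0.
exists A0, Acl => n phi v; by rewrite (sat_substructure tv).
Qed.

(** * Dividing chains *)

Lemma finite_params L (W V : Type) (s : seq (formula L (W + V))) :
  exists r (q : 'I_r -> V) (f : V -> 'I_r), forall phi, List.In phi s ->
    forall (M : structure L) (w : W -> M) (v : V -> M),
      sat phi (sumv w (v \o q \o f)) = sat phi (sumv w v).
Proof.
have [[x0]|V0] := pselect (inhabited V); last first.
  have f (x : V) : 'I_0 by case: V0; split.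
  have q (i : 'I_0) : V by case: i.
  exists 0, q, f => phi _ M w v; congr sat; apply/funext => -[//|y] /=.
  by case: V0; split.
have /choice[sup hsup] := fun phi => @sat_support L (W + V) phi.
pose l : seq {classic V} := x0 :: List.flat_map
  (fun z => match z with inl _ => [::] | inr y => [:: y] end) (List.flat_map sup s).
exists (size l), (tnth (in_tuple l)), (fun y => inord (index (y : {classic V}) l)).
move=> phi phis M w v; apply: hsup => -[//|y] hy /=.
rewrite (tnth_nth (x0 : {classic V})) /=; congr v.
have hl : (y : {classic V}) \in l.
  rewrite inE; apply/orP; right.
  have : List.In (inr y) (List.flat_map sup s) by apply/List.in_flat_map; exists phi.
  elim: (List.flat_map sup s) => //= z s' IH [->|/IH]; first by rewrite /= inE eqxx.
  by case: z => //= z; rewrite inE => ->; rewrite orbT.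
by rewrite inordK ?nth_index // -ltnS; move: hl; rewrite -index_mem.
Qed.

Lemma formula_params L (W V : Type) (phi : formula L (W + V)) :
  exists r (psi : formula L (W + 'I_r)) (q : 'I_r -> V),
    forall (M : structure L) (w : W -> M) (v : V -> M),
      sat psi (sumv w (v \o q)) = sat phi (sumv w v).
Proof.
have [r [q [f h]]] := finite_params [:: phi].
exists r, (rename phi (fun z => match z with inl x => inl x | inr y => inr (f y) end)), q.
move=> M w v; rewrite -(h phi (or_introl erefl)) sat_rename; congr sat.
by apply/funext => -[].
Qed.

Lemma same_type_sat L (U : structure L) (A : set U) m (c c' : 'I_m -> U)
    (V : Type) (p : V -> U) (phi : formula L ('I_m + V)) :
  same_type A c c' -> (forall x, A (p x)) ->
  sat phi (sumv c p) <-> sat phi (sumv c' p).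
Proof.
move=> cc' Ap; have [r [psi [q h]]] := formula_params phi.
by rewrite -!h; apply: (cc' (Inst psi (p \o q))) => i; exact: Ap.
Qed.

Lemma same_type_of_imp L (U : structure L) (A : set U) m (c c' : 'I_m -> U) :
  (forall theta : pformula U m, over A theta -> psat c theta -> psat c' theta) ->
  same_type A c c'.
Proof.
move=> h theta otheta; split; first exact: h.
by move=> h'; apply: contrapT => nc; exact: (h (pnot theta) otheta nc h').
Qed.

Lemma consistent_range L (U : structure L) (I : Type) n m (phi : formula L ('I_n + 'I_m))
    (c : I -> 'I_m -> U) :
  consistent (range (fun i => Inst phi (c i))) <->
  forall s : seq I, exists b, forall i, List.In i s -> sat2 phi b (c i).
Proof.
rewrite consistentP; split=> [H s|H S hS].
  have [theta /List.in_map_iff[i [<- _]]|b hb] := H (List.map (fun i => Inst phi (c i)) s).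
    by exists i.
  by exists b => i hi; have := hb (Inst phi (c i)); apply; apply/List.in_map.
have [s hs] : exists s, forall theta, List.In theta S ->
    exists2 i, List.In i s & theta = Inst phi (c i).
  elim: S hS => [|theta S IH] hS; first by exists [::].
  have [|s hs] := IH; first by move=> z hz; apply: hS; right.
  have [i _ <-] := hS theta (or_introl erefl).
  exists (i :: s) => z [<-|/hs[j hj ->]]; first by exists i => //; left.
  by exists j => //; right.
by have [b hb] := H s; exists b => theta /hs[i /hb hi ->].
Qed.

Lemma k_inconsistentE L (U : structure L) n m (phi : formula L ('I_n + 'I_m))
    (c : nat -> 'I_m -> U) k :
  k_inconsistent k (fun i => Inst phi (c i)) <->
  forall g : 'I_k -> nat, injective g -> ~ exists b, forall i, sat2 phi b (c (g i)).
Proof.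
rewrite /k_inconsistent; split=> H g /H + => h; apply: contra_not h.
  by move=> [b hb]; apply/(consistent_range phi (fun i => c (g i))) => s; exists b.
move=> /(consistent_range phi (fun i => c (g i)))/(_ (enum 'I_k))[b hb].
by exists b => i; apply/hb/In_enum.
Qed.

Lemma common_solution_formula L n m (phi : formula L ('I_n + 'I_m)) k :
  exists chi : formula L ('I_k * 'I_m), forall (U : structure L) (v : 'I_k * 'I_m -> U),
    sat chi v <-> exists b, forall i, sat2 phi b (fun l => v (i, l)).
Proof.
have [chi hchi] := ex_closure (V1 := 'I_n) (V2 := 'I_k * 'I_m) (Conjs (List.map
  (fun i => rename phi (fun z => match z with inl x => inl x | inr l => inr (i, l) end)) (enum 'I_k))).
exists chi => U v; rewrite hchi; split=> -[b hb]; exists b.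
  move=> i; have := hb; rewrite sat_Conjs_map => /(_ i); rewrite sat_rename /sat2.
  by congr sat; apply/funext => -[].
rewrite sat_Conjs_map => i; rewrite sat_rename; have := hb i; rewrite /sat2.
by congr sat; apply/funext => -[].
Qed.

Lemma automorphism_id L (U : structure L) : automorphism (@id U).
Proof. by split=> //; exists id. Qed.

Lemma automorphism_comp L (U : structure L) (s t : U -> U) :
  automorphism s -> automorphism t -> automorphism (s \o t).
Proof.
move=> [bs sf sr] [bt tf tr]; split; first exact: bij_comp.
  by move=> n f xs /=; rewrite tf sf.
by move=> n r xs; rewrite (tr _ _ xs) (sr _ _ (fun i => t (xs i))).
Qed.

Lemma sat2_automorphism L (U : structure L) (s : U -> U) n m
    (phi : formula L ('I_n + 'I_m)) b c : automorphism s ->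
  sat2 phi (s \o b) (s \o c) = sat2 phi b c.
Proof.
move=> sa; rewrite /sat2 -[RHS](sat_automorphism sa); congr sat.
by apply/funext => -[].
Qed.

Lemma k_inconsistent_automorphism L (U : structure L) (s : U -> U) n m
    (phi : formula L ('I_n + 'I_m)) (c : nat -> 'I_m -> U) k : automorphism s ->
  k_inconsistent k (fun i => Inst phi (c i)) ->
  k_inconsistent k (fun i => Inst phi (s \o c i)).
Proof.
move=> sa /k_inconsistentE h.
apply/(k_inconsistentE _ (fun i => s \o c i)) => g /h + [b hb]; apply.
have [[s' s's ss'] _ _] := sa; exists (s' \o b) => i.
by rewrite -(sat2_automorphism _ _ _ sa) (_ : s \o (s' \o b) = b) //; apply/funext => j /=.
Qed.

Lemma tree_property_of_dividing_chain K L (T : theory L) (U : structure L)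
    (hU : monster K T U) n m (psi : formula L ('I_n + 'I_m)) k (M : nat -> set U)
    (c : nat -> 'I_m -> U) (a : 'I_n -> U) :
  (forall i, tiny L {x | M i x}) -> (forall i, M i `<=` M i.+1) ->
  (forall i l, M i.+1 (c i l)) -> (forall i, sat2 psi a (c i)) ->
  (forall i, exists d : nat -> 'I_m -> U, (forall j, same_type (M i) (d j) (c i)) /\
    k_inconsistent k (fun j => Inst psi (d j))) ->
  has_tree_property U psi.
Proof.
move=> tM MS Mc ac /choice[d hd].
have ht0 : forall i j, exists t : U -> U,
    [/\ automorphism t, forall x, M i x -> t x = x & forall l, t (c i l) = d i j l].
  move=> i j.
  have [|s [sa hs]] := homogeneity hU (c := sumv (c i) sval) (d := sumv (d i j) sval)
    (tiny_sum (tiny_count L 'I_m) (tM i)).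
    move=> phi; apply: same_type_sat => [theta otheta|x]; last exact: (svalP x).
    exact: iff_sym ((hd i).1 j theta otheta).
  exists s; split=> // [x Mx|l]; first exact: (hs (inr (exist _ x Mx))).
  exact: (hs (inl l)).
have /choice[t ht] : forall i, exists t : nat -> U -> U, forall j,
    [/\ automorphism (t j), forall x, M i x -> t j x = x & forall l, t j (c i l) = d i j l].
  by move=> i; have /choice[t ht] := ht0 i; exists t.
pose fix aut (l : seq nat) : U -> U :=
  if l is j :: l' then aut l' \o t (size l').+1 j else id.
have autP l : automorphism (aut l).
  elim: l => [|j l IH]; first exact: automorphism_id.
  by apply: automorphism_comp => //; case: (ht (size l).+1 j).
exists (fun eta => aut (rev eta) \o c (size eta)), k; split=> [eta|eta].
  rewrite (_ : (fun i => _) = fun i => Inst psi (aut (rev eta) \o d (size eta).+1 i)).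
    by apply: k_inconsistent_automorphism => //; case: (hd (size eta).+1).
  apply/funext => i; congr Inst; apply/funext => l.
  rewrite rev_rcons size_rcons /= size_rev.
  by have [_ _ ->] := ht (size eta).+1 i.
have MM i j : i <= j -> M i `<=` M j.
  by move=> /subnK <-; elim: (j - i) => // p IH x /IH /MS.
apply/(consistent_range psi (fun i => _)) => s.
have E N i : i <= N ->
    aut (rev (mkseq eta i)) \o c i = aut (rev (mkseq eta N)) \o c i.
  move=> /subnK <-; elim: (N - i) => // p ->; apply/funext => l.
  rewrite addSn mkseqS rev_rcons /= size_rev size_mkseq.
  have [_ -> //] := ht (p + i).+1 (eta (p + i)).
  by apply: (MM i.+1) => //; rewrite ltnS leq_addl.
pose N := \max_(i <- s) i.
have hN i : List.In i s -> i <= N by exact: In_bigmax.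
exists (aut (rev (mkseq eta N)) \o a) => i /hN /E Ei.
by rewrite size_mkseq Ei sat2_automorphism.
Qed.

Lemma well_order_exists (X : Type) : exists lt : X -> X -> Prop,
  [/\ forall x, ~ lt x x, forall x y z, lt x y -> lt y z -> lt x z,
      forall x y, x = y \/ lt x y \/ lt y x &
      forall P : set X, P !=set0 -> exists2 x, P x & forall y, P y -> ~ lt y x].
Proof.
have [R wo] := wochoice.well_ordering_principle {classic X}.
have min (P : set X) : P !=set0 ->
    exists x, [/\ P x, forall y, P y -> R x y & forall z, P z -> (forall y, P y -> R z y) -> x = z].
  move=> [x0 Px0]; have [|x [[hx1 hx2] hx3]] := wo (fun x => `[< P x >]).
    by exists x0; rewrite unfold_in; apply/asboolP.
  exists x; split; first by move: hx1; rewrite unfold_in => /asboolP.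
    by move=> y Py; apply: hx2; rewrite unfold_in; apply/asboolP.
  move=> z Pz hz; apply: hx3; split; first by rewrite unfold_in; apply/asboolP.
  by move=> y; rewrite unfold_in => /asboolP/hz.
have refl x : R x x.
  by have [|y [-> h _]] := min [set x]; [exists x|apply: h].
have total x y : R x y \/ R y x.
  have [|z [[->|->] h _]] := min [set x; y]; first by exists x; left.
    by left; apply: h; right.
  by right; apply: h; left.
have anti x y : R x y -> R y x -> x = y.
  move=> xy yx; have [|z [_ _ h]] := min [set x; y]; first by exists x; left.
  have <- := h x; [apply: h|by left|by move=> w [->|->]]; first by right.
  by move=> w [->|->].
have trans x y z : R x y -> R y z -> R x z.
  move=> xy yz; have [|w [[[->|->]|->] h _]] := min [set x; y; z]; first by exists x; left; left.
  - by apply: h; right.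
  - have -> : x = y by apply: anti => //; apply: h; left; left.
    by [].
  - have e : y = z by apply: anti => //; apply: h; left; right.
    by rewrite -e.
exists (fun x y => R x y /\ x <> y); split=> [x []//|x y z [xy nxy] [yz nyz]|x y|P /min[x [Px hx _]]].
- split; first exact: trans yz.
  by move=> e; apply: nxy; apply: anti => //; rewrite e.
- have [e|n] := pselect (x = y); first by left.
  by right; have [h|h] := total x y; [left|right; split => // e; apply: n].
- exists x => // y Py [yx]; apply; apply: anti => //; exact: hx.
Qed.

Lemma infinite_increasing (X : Type) (lt : X -> X -> Prop) (P : set X) :
  (forall x y, x = y \/ lt x y \/ lt y x) ->
  (forall P : set X, P !=set0 -> exists2 x, P x & forall y, P y -> ~ lt y x) ->
  infinite_set P -> exists x : nat -> X, forall i, P (x i) /\ lt (x i) (x i.+1).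
Proof.
move=> tot min Pinf.
pose I x := P x /\ finite_set [set y | P y /\ ~ lt x y].
have [x0 Ix0] : exists x, I x.
  have [|x Px hx] := min P; first exact: infinite_setN0.
  exists x; split=> //; apply: sub_finite_set (finite_set1 x) => y [Py ny].
  by have [->//|[//|yx]] := tot x y; case: (hx y).
have step (x : {x | I x}) : exists y : {x | I x}, lt (sval x) (sval y).
  case: x => x [Px fx] /=.
  have [|y [Py xy] hy] := min [set y | P y /\ lt x y].
    apply: contrapT => n; apply: Pinf; apply: sub_finite_set fx => y Py; split=> // xy.
    by apply: n; exists y.
  suff Iy : I y by exists (exist _ y Iy).
  split=> //; apply: sub_finite_set (_ : finite_set ([set y | P y /\ ~ lt x y] `|` [set y])).
    move=> z [Pz nz]; have [xz|xz] := pselect (lt x z); last by left.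
    by right; have [->|[//|zy]] := tot y z; last by case: (hy z).
  by rewrite finite_setU.
have [f hf] := choice step.
pose x i := sval (iter i f (exist _ x0 Ix0)).
by exists x => i; split; [exact: (svalP (iter i f _)).1|exact: hf].
Qed.

Lemma no_injection_set (X : Type) (j : set X -> X) : ~ injective j.
Proof.
move=> ji; pose D := [set x | exists2 A, j A = x & ~ A x].
have [Dj|nDj] := pselect (D (j D)); last by apply: (nDj); exists D.
by have [A /ji -> ] := Dj; apply.
Qed.

Lemma infinite_fiber L (f : set (formula L nat) -> nat * nat * formula L nat) :
  exists c, infinite_set [set x | f x = c].
Proof.
apply: contrapT => n.
have /choice[s hs] : forall c, exists s, forall x, f x = c -> List.In x s.
  move=> c; have [fin|inf] := pselect (finite_set [set x | f x = c]).
    by have [s hs] := finite_set_In fin; exists s => x /hs.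
  by case: n; exists c.
pose g x := @index {classic set (formula L nat)} x (s (f x)).
apply: (@no_injection_set _ (fun x => Imp (numeral L (f x).1.1)
  (Imp (numeral L (f x).1.2) (Imp (numeral L (g x)) (f x).2)))).
move=> x y [] /numeral_inj e1 /numeral_inj e2 /numeral_inj e3 e4.
have e : f x = f y by move: e1 e2 e4; case: (f x) => [[? ?] ?]; case: (f y) => [[? ?] ?] /= -> -> ->.
have mem z : (z : {classic set (formula L nat)}) \in (s (f z) : seq {classic set (formula L nat)}).
  exact/In_mem/hs.
have := mem x; have := mem y; move: e3; rewrite /g e => e3 hy hx.
by have := index_inj x hx hy e3.
Qed.

Lemma infinite_nat_enum (A : set nat) : infinite_set A ->
  exists h : nat -> nat, injective h /\ forall i, A (h i).
Proof. by move=> /infiniteP/card_leT_inj. Qed.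

Lemma infinite_nat_split (A : set nat) : infinite_set A \/ infinite_set (~` A).
Proof.
have [fA|] := pselect (finite_set A); last by left.
right=> fC; apply: infinite_nat; rewrite -(setUv A); by rewrite finite_setU.
Qed.

Lemma homogeneous_subsequence (s : seq (set nat)) :
  exists h : nat -> nat, injective h /\
    forall Q, List.In Q s -> forall j, Q (h j) <-> Q (h 0).
Proof.
elim: s => [|Q s [h [hi hh]]]; first by exists id; split=> [x y|].
have [g [gi hg]] : exists g : nat -> nat, injective g /\ forall j, Q (h (g j)) <-> Q (h (g 0)).
  have [inf|inf] := infinite_nat_split (h @^-1` Q).
    have [g [gi hg]] := infinite_nat_enum inf; exists g; split=> // j.
    by split=> _; [exact: (hg 0)|exact: (hg j)].
  have [g [gi hg]] := infinite_nat_enum inf; exists g; split=> // j.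
  by split=> H; [case: (hg j)|case: (hg 0)].
exists (h \o g); split=> [|P [<-//|Ps] j /=]; first exact: inj_comp.
by rewrite (hh _ Ps) (hh _ Ps (g 0)).
Qed.

Fixpoint descending (X : Type) (lt : X -> X -> Prop) (s : seq X) : Prop :=
  if s is x :: s' then (forall y, List.In y s' -> lt y x) /\ descending lt s' else True.

Lemma descending_exists (X : Type) (lt : X -> X -> Prop) (s : seq X) :
  (forall x y z, lt x y -> lt y z -> lt x z) ->
  (forall x y, x = y \/ lt x y \/ lt y x) ->
  exists2 s', descending lt s' & forall x, List.In x s -> List.In x s'.
Proof.
move=> trans tot; elim: s => [|x s [s1 ds1 ss1]]; first by exists [::].
suff [s2 [ds2 s2x s2s]] : exists s2, [/\ descending lt s2,
    forall y, List.In y s2 -> y = x \/ List.In y s1 & forall y, y = x \/ List.In y s1 -> List.In y s2].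
  by exists s2 => // y [<-|/ss1 hy]; apply: s2s; [left|right].
elim: s1 ds1 {ss1} => [_|y s1 IH [hy ds1]].
  by exists [:: x]; split=> //= y [->|//]; left.
have [e|[xy|yx]] := tot x y.
- exists (y :: s1); split=> // z; first by right.
  by case=> [->|//]; left; rewrite e.
- have [s2 [ds2 s2x s2s]] := IH ds1; exists (y :: s2); split.
  + by split=> // z /s2x[->|/hy].
  + by move=> z [<-|/s2x[->|h]]; [right; left|left|right; right].
  + by move=> z [->|[<-|h]]; [right; apply: s2s; left|left|right; apply: s2s; right].
- exists (x :: y :: s1); split.
  + split=> [z [<-//|/hy zy]|]; last by split.
    exact: trans yx.
  + by move=> z [<-|h]; [left|right].
  + by move=> z [->|h]; [left|right].
Qed.

Definition scons (T : Type) (u : T) (y : nat -> T) (i : nat) : T :=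
  if i is j.+1 then y j else u.

Definition skterm L (X : Type) := wtree (option X) (formula L nat).

Fixpoint skeval L (X T : Type) (sk : formula L nat -> (nat -> T) -> T) (u0 : T)
    (beta : X -> T) (t : skterm L X) : T :=
  match t with
  | Leaf None => u0
  | Leaf (Some x) => beta x
  | Node chi ts => sk chi (fun i => skeval sk u0 beta (ts i))
  end.

Fixpoint leaves_in L (X : Type) (P : set X) (t : skterm L X) : Prop :=
  match t with
  | Leaf None => True
  | Leaf (Some x) => P x
  | Node _ ts => forall i, leaves_in P (ts i)
  end.

Lemma leaves_inW L (X : Type) (P Q : set X) (t : skterm L X) :
  P `<=` Q -> leaves_in P t -> leaves_in Q t.
Proof. by move=> PQ; elim: t => [[x|]|chi ts IH] //= => [/PQ|h i]; last exact/IH. Qed.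

Lemma skeval_local L (X T : Type) (sk : formula L nat -> (nat -> T) -> T) u0
    (P : set X) (b b' : X -> T) (t : skterm L X) :
  (forall x, P x -> b x = b' x) -> leaves_in P t ->
  skeval sk u0 b t = skeval sk u0 b' t.
Proof.
move=> bb'; elim: t => [[x|]|chi ts IH] //=; first exact: bb'.
by move=> h; congr sk; apply/funext => i; exact: IH.
Qed.

Lemma tree_finite_stage (X D I : Type) (lt : X -> X -> Prop) (a : seq nat -> D)
    (holds : I -> X -> (X -> D) -> D -> Prop) (cs : seq I) (xs : seq X) (d0 : D) :
  (forall x, ~ lt x x) -> (forall x y z, lt x y -> lt y z -> lt x z) ->
  (forall c x b b' e, (forall y, lt y x -> b y = b' y) -> holds c x b e <-> holds c x b' e) ->
  descending lt xs ->
  exists (b : X -> D) (b' : X -> nat -> D) (eta : seq nat),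
    forall x, List.In x xs ->
    [/\ exists2 i, i <= size eta & b x = a (take i eta),
        exists eta' h, injective h /\ forall j, b' x j = a (rcons eta' (h j)) &
        forall c, List.In c cs -> forall j, holds c x b (b' x j) <-> holds c x b (b x)].
Proof.
move=> irr trans loc; elim: xs => [_|x xs IH [ltx dxs]].
  by exists (fun=> d0), (fun _ _ => d0), [::].
have [b [b' [eta hb]]] := IH dxs.
have [h [hi hh]] := homogeneous_subsequence
  (List.map (fun c j => holds c x b (a (rcons eta j))) cs).
pose upd T (f : X -> T) d y := if `[< y = x >] then d else f y.
have updx T f d : upd T f d x = d by rewrite /upd asboolT.
have updn T f d y : lt y x -> upd T f d y = f y.
  by move=> yx; rewrite /upd asboolF // => e; apply: (irr x); rewrite -{1}e.
exists (upd _ b (a (rcons eta (h 0)))), (upd _ b' (fun j => a (rcons eta (h j)))), (rcons eta (h 0)).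
move=> y [<-|hy].
  rewrite !updx; split.
  - by exists (size eta).+1; rewrite ?size_rcons // -(size_rcons eta (h 0)) take_size.
  - by exists eta, h.
  - move=> c hc j; rewrite !(loc c x _ b); try by move=> z zx; rewrite updn.
    by have := hh _ (List.in_map _ _ _ hc) j.
have yx := ltx y hy; have [[i hieta e] h2 h3] := hb y hy.
rewrite !(updn _ _ _ _ yx); split=> //.
  exists i; first by rewrite size_rcons ltnW.
  by rewrite -cats1 takel_cat.
move=> c hc j; rewrite !(loc c y _ b); first exact: h3.
  by move=> z zy; rewrite updn //; exact: trans yx.
by move=> z zy; rewrite updn //; exact: trans yx.
Qed.

Lemma skolem_functions L (U : structure L) :
  exists sk : formula L nat -> (nat -> U) -> U,
    forall chi y u, sat chi (scons u y) -> sat chi (scons (sk chi y) y).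
Proof.
have [u0] := carrier_inh U.
have ex (p : formula L nat * (nat -> U)) :
    exists w, forall u, sat p.1 (scons u p.2) -> sat p.1 (scons w p.2).
  have [[u hu]|n] := pselect (exists u, sat p.1 (scons u p.2)); first by exists u.
  by exists u0 => u hu; case: n; exists u.
have /choice[f hf] := ex; exists (fun chi y => f (chi, y)) => chi y u.
exact: (hf (chi, y)).
Qed.

Lemma descending_models K L (T : theory L) (U : structure L) (hU : monster K T U)
    n m (phi : formula L ('I_n + 'I_m)) (X : Type) (lt : X -> X -> Prop) :
  tiny L X -> (forall x, ~ lt x x) -> (forall x y z, lt x y -> lt y z -> lt x z) ->
  (forall x y, x = y \/ lt x y \/ lt y x) -> has_tree_property U phi ->
  exists (M : set X -> set U) (b : X -> 'I_m -> U) (a : 'I_n -> U),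
    [/\ forall P, tiny L {u | M P u} /\ elementary_substructure (M P),
        forall P Q, P `<=` Q -> M P `<=` M Q,
        forall (P : set X) x, P x -> forall l, M P (b x l),
        forall x, sat2 phi a (b x) &
        forall x, divides (M [set y | lt y x]) (Inst phi (b x))].
Proof.
move=> tX irr trans tot [tr [k [trk trc]]].
have [sk hsk] := skolem_functions U; have [u0] := carrier_inh U.
pose tm := skterm L (X * 'I_m).
pose V := (tm + ('I_n + X * nat * 'I_m))%type.
have ttm : tiny L tm.
  by apply: tiny_wtree; [apply: tiny_option; apply: tiny_prod => //; exact: tiny_count|exact: tiny_formula].
have tV : tiny L V.
  by repeat first [exact: ttm | exact: tX | exact: tiny_count | apply: tiny_sum | apply: tiny_prod].
pose va l : V := inr (inl l).
pose vb x l : V := inl (Leaf (Some (x, l))).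
pose vc x j l : V := inr (inr (x, j, l)).
have [chik hchik] := common_solution_formula phi k.
pose below x (y : X * 'I_m) := lt y.1 x.
pose Phi1 (p : formula L V) := exists (chi : formula L nat) ts, p = Imp
  (Ex (rename chi (fun i => if i is j.+1 then Some (inl (ts j)) else None)))
  (rename chi (fun i => if i is j.+1 then inl (ts j) else inl (Node chi ts))).
pose Phi2 (p : formula L V) := exists x, p = rename phi (sumv va (vb x)).
pose Phi3 (p : formula L V) := exists x (g : 'I_k -> nat), injective g /\
  p = Not (rename chik (fun z => vc x (g z.1) z.2)).
pose Cond := {r : nat & (formula L ('I_m + 'I_r) * ('I_r -> tm))%type}.
pose Phi4 (p : formula L V) := exists x (c : Cond) j,
  (forall i, leaves_in (below x) ((projT2 c).2 i)) /\
  p = Imp (rename (projT2 c).1 (sumv (vb x) (fun i => inl ((projT2 c).2 i))))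
          (rename (projT2 c).1 (sumv (vc x j) (fun i => inl ((projT2 c).2 i)))).
pose ev (be : X -> 'I_m -> U) (t : tm) := skeval sk u0 (fun z => be z.1 z.2) t.
pose holds (c : Cond) (x : X) (be : X -> 'I_m -> U) (e : 'I_m -> U) :=
  (forall i, leaves_in (below x) ((projT2 c).2 i)) /\
  sat (projT2 c).1 (sumv e (fun i => ev be ((projT2 c).2 i))).
pose good (xs : seq X) (cs : seq Cond) be be' (a : 'I_n -> U) := forall x, List.In x xs ->
  [/\ sat2 phi a (be x),
      forall g : 'I_k -> nat, injective g -> ~ exists b, forall i, sat2 phi b (be' x (g i)) &
      forall c, List.In c cs -> forall j, holds c x be (be x) -> holds c x be (be' x j)].
have goodW xs xs' cs cs' be be' a : good (xs ++ xs') (cs ++ cs') be be' a ->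
    good xs cs be be' a /\ good xs' cs' be be' a.
  move=> h; split=> x hx.
    have [|h1 h2 h3] := h x; first by apply/List.in_app_iff; left.
    by split=> // c hc j; apply: h3; apply/List.in_app_iff; left.
  have [|h1 h2 h3] := h x; first by apply/List.in_app_iff; right.
  by split=> // c hc j; apply: h3; apply/List.in_app_iff; right.
pose asg be (be' : X -> nat -> 'I_m -> U) a : V -> U :=
  sumv (ev be) (sumv a (fun z => be' z.1.1 z.1.2 z.2)).
have good_exists xs cs : exists be be' a, good xs cs be be' a.
  have [xs' dxs sub] := descending_exists xs trans tot.
  have [|be [be' [eta h]]] := @tree_finite_stage X ('I_m -> U) Cond lt tr holds cs xs' (fun=> u0) irr trans _ dxs.
    move=> c x b b' e bb'; rewrite /holds; split=> -[h1 h2]; split=> //; move: h2; congr sat; congr sumv;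
      apply/funext => i; apply: (@skeval_local L _ U sk u0 (below x)) => // z; rewrite /below => /bb' -> //.
  have /(consistent_range phi (fun i => _))/(_ (iota 0 (size eta).+1))[a ha] := trc (nth 0 eta).
  exists be, be', a => x /sub /h[[i hi ex] [eta' [g [gi hg]]] hc]; split.
  - have := ha i; rewrite ex (_ : mkseq _ i = take i eta); first apply.
      by apply/In_mem; rewrite mem_iota.
    apply: (@eq_from_nth _ 0); first by rewrite size_mkseq size_takel.
    by rewrite size_mkseq => j hj; rewrite nth_mkseq // nth_take.
  - move=> f fi [b hb]; have /(k_inconsistentE phi (fun i => _)) := trk eta'.
    move=> /(_ (g \o f)); apply; first exact: inj_comp.
    by exists b => l; have := hb l; rewrite hg.
  - by move=> c /hc hcj j; apply: (hcj j).2.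
have fin s : (forall p, List.In p s -> [\/ Phi1 p, Phi2 p, Phi3 p | Phi4 p]) ->
    exists xs cs, forall be be' a, good xs cs be be' a ->
      forall p, List.In p s -> sat p (asg be be' a).
  elim: s => [|p s IH] hs; first by exists [::], [::].
  have [|xs [cs h]] := IH; first by move=> q hq; apply: hs; right.
  suff [xs' [cs' h']] : exists xs cs, forall be be' a, good xs cs be be' a -> sat p (asg be be' a).
    exists (xs' ++ xs), (cs' ++ cs) => be be' a /goodW[g1 g2] q [<-|]; first exact: h'.
    exact: h.
  have [[chi [ts ->]]|[x ->]|[x [g [gi ->]]]|[x [c [j [hc ->]]]]] := hs p (or_introl erefl).
  - exists [::], [::] => be be' a _ /=; rewrite -/(sat _ _).
    rewrite -[_ -> False]/(sat (Ex _) _) sat_Ex => -[u]; rewrite !sat_rename.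
    move=> hu; have := @hsk chi (fun i => ev be (ts i)) u.
    move=> H; have : sat chi (scons u (fun i => ev be (ts i))).
      by move: hu; congr sat; apply/funext => -[].
    by move=> /H; congr sat; apply/funext => -[].
  - exists [:: x], [::] => be be' a /(_ x (or_introl erefl))[h1 _ _].
    by rewrite sat_rename; move: h1; rewrite /sat2; congr sat; apply/funext => -[].
  - exists [:: x], [::] => be be' a /(_ x (or_introl erefl))[_ h1 _] /=.
    rewrite sat_rename => /hchik H; exact: (h1 g gi H).
  - exists [:: x], [:: c] => be be' a /(_ x (or_introl erefl))[_ _ /(_ c (or_introl erefl) j) h1].
    rewrite /= !sat_rename => h2; have [|_] := h1.
      by split=> //; move: h2; congr sat; apply/funext => -[].
    by congr sat; apply/funext => -[].
have [|v [hv _]] := compactness hU (R0 := set0) (Phi := fun p => [\/ Phi1 p, Phi2 p, Phi3 p | Phi4 p]) tV.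
  move=> s l /fin[xs [cs h]] hl; have [be [be' [a g]]] := good_exists xs cs.
  exists (asg be be' a); split=> [|z /hl //]; exact: h.
pose M (P : set X) : set U := [set u | exists2 t, leaves_in (fun z => P z.1) t & v (inl t) = u].
exists M, (fun x => v \o vb x), (v \o va); split.
- move=> P; split.
    by apply: (tiny_sig (f := fun t => v (inl t))) ttm => u [t _ <-]; exists t.
  apply: tarski_vaught; first by exists (v (inl (Leaf None))), (Leaf None).
  move=> chi y u /(_ _)/cid2-/all_sig2[ts hts vts] hu.
  have := hv _ (Or41 _ _ _ (ex_intro _ chi (ex_intro _ ts erefl))).
  rewrite -[sat (Imp _ _) _]/(sat (Ex _) _ -> sat _ _) sat_Ex sat_rename => H.
  exists (v (inl (Node chi ts))); first by exists (Node chi ts).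
  have /H : exists u, sat (rename chi (fun i => if i is j.+1 then Some (inl (ts j)) else None))
     (oapp v u).
    exists u; rewrite sat_rename; move: hu; congr sat.
    by apply/funext => -[|j] //=; rewrite vts.
  by congr sat; apply/funext => -[|j] //=; rewrite vts.
- move=> P Q PQ u [t ht <-]; exists t => //; apply: leaves_inW ht.
  by move=> z; exact: PQ.
- by move=> P x Px l; exists (Leaf (Some (x, l))).
- move=> x; have := hv _ (Or42 _ _ _ (ex_intro _ x erefl)).
  by rewrite sat_rename /sat2; congr sat; apply/funext => -[].
- move=> x; exists k, (fun j => v \o vc x j); split=> [j|]; last first.
    apply/(k_inconsistentE phi (fun j => v \o vc x j)) => g gi [b hb].
    have := hv _ (Or43 _ _ _ (ex_intro _ x (ex_intro _ g (conj gi erefl)))).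
    by rewrite sat_Not sat_rename; apply; apply/hchik; exists b.
  suff h : same_type (M [set y | lt y x]) (v \o vb x) (v \o vc x j).
    by move=> theta otheta; exact: iff_sym (h theta otheta).
  apply: same_type_of_imp => -[r th p] /(_ _)/cid2-/all_sig2[q hq vq].
  pose c : Cond := existT _ r (th, q).
  have := hv _ (Or44 _ _ _ (ex_intro _ x (ex_intro _ c (ex_intro _ j (conj hq erefl))))).
  rewrite /psat /sat2 /= !sat_rename => H h.
  have E (w : 'I_m -> V) : v \o sumv w (fun i => inl (q i)) =
      (fun z => match z with inl i => (v \o w) i | inr i => p i end).
    by apply/funext => -[i|i] //=; rewrite vq.
  by rewrite -(E (vc x j)); apply: H; rewrite E.
Qed.

Definition type_of L (U : structure L) n (N : set U) (a : 'I_n -> U) : set (pformula U n) :=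
  [set theta | over N theta /\ psat a theta].

Lemma complete_type_of L (U : structure L) n (N : set U) (a : 'I_n -> U) :
  complete_type N (type_of N a).
Proof.
split=> [theta []//|S _ hS|theta oth]; first by exists a => theta /hS[].
by have [h|h] := pselect (psat a theta); [left|right].
Qed.

Lemma small_model_of_tiny K L (T : theory L) (U : structure L) (hU : monster K T U)
    (M : set U) : tiny L {u | M u} -> elementary_substructure M -> small_model K M.
Proof.
case: hU => sl sF _ _ _ tM eM; split=> //.
by apply: (small_sub_range (f := sval) sl sF tM) => u Mu; exists (exist _ u Mu).
Qed.

Definition flat_var n m (z : 'I_n + 'I_m) : nat :=
  match z with inl i => i | inr j => n + j end.

Lemma sat_rename_flat_var L (U : structure L) n m (p q : formula L ('I_n + 'I_m)) v :
  rename p (@flat_var n m) = rename q (@flat_var n m) -> sat (M := U) p v = sat q v.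
Proof.
move=> e; have [u0] := carrier_inh U.
pose w i := match insub i : option 'I_n with Some i' => v (inl i') | None =>
  match insub (i - n) : option 'I_m with Some j => v (inr j) | None => u0 end end.
have vw : v = w \o @flat_var n m.
  apply/funext => -[i|j]; rewrite /w /= ?valK //.
  by rewrite insubN ?addKn ?valK // -leqNgt leq_addr.
by rewrite vw -(sat_rename p (@flat_var n m) w) e sat_rename.
Qed.

Lemma simple_dividing_simple K L (T : theory L) (U : structure L) (hU : monster K T U) :
  simple_dividing U K -> simple_theory U.
Proof.
move=> sd n m phi tp.
have [lt [irr trans tot wf]] := well_order_exists (set (formula L nat)).
have [M [b [a [MP Mmono Mb ab Mdiv]]]] :=
  descending_models hU (tiny_set_formula L) irr trans tot tp.
pose M' x := M [set y | lt y x \/ y = x].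
pose wit x (z : nat * nat * formula L nat) :=
  exists (psi : formula L ('I_n + 'I_z.1.1)) (c : 'I_z.1.1 -> U),
  [/\ simple_formula U psi, z.2 = rename psi (@flat_var n z.1.1), forall j, M' x (c j), sat2 psi a c &
    exists d : nat -> 'I_z.1.1 -> U, (forall j, same_type (M [set y | lt y x]) (d j) c) /\
      k_inconsistent z.1.2 (fun j => Inst psi (d j))].
have /choice[f hf] : forall x, exists z, wit x z.
  move=> x.
  have smM P : small_model K (M P).
    by apply: (small_model_of_tiny hU); case: (MP P).
  have MM' : M [set y | lt y x] `<=` M' x by apply: Mmono => y; left.
  have [|m1 [psi [c [spsi Nc [_ pc] [k [d [hd kd]]]]]]] :=
      sd _ _ (smM _) (smM _) MM' n (type_of (M' x) a) (complete_type_of _ _).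
    exists (Inst phi (b x)); split; last exact: Mdiv.
    by move=> a' h; apply: h; split; [move=> l; apply: Mb; right|exact: ab].
  by exists (m1, k, rename psi (@flat_var n m1)), psi, c; split=> //; exists d.
have [[[m1 k] q] inf] := infinite_fiber f.
have [x hx] := infinite_increasing tot wf inf.
have {hf}hf i : wit (x i) (m1, k, q) by have [<- _] := hx i.
have [psi [_ [spsi qpsi _ _ _]]] := hf 0; apply: spsi.
have /choice[c hc] : forall i, exists c : 'I_m1 -> U,
    [/\ forall j, M' (x i) (c j), sat2 psi a c &
    exists d : nat -> 'I_m1 -> U, (forall j, same_type (M [set y | lt y (x i)]) (d j) c) /\
      k_inconsistent k (fun j => Inst psi (d j))].
  move=> i; have [psi' [c [_ /= qpsi' hc ac [d [hd kd]]]]] := hf i.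
  have e := sat_rename_flat_var _ (etrans (esym qpsi) qpsi').
  exists c; split=> //; first by rewrite /sat2 e.
  exists d; split=> //; apply/(k_inconsistentE psi d) => g gi [b0 hb0].
  move/(k_inconsistentE psi' d): kd => /(_ g gi); apply; exists b0 => j.
  by rewrite /sat2 -e; exact: hb0.
apply: (@tree_property_of_dividing_chain _ _ _ _ hU _ _ psi k
    (fun i => M [set y | lt y (x i)]) c a).
- by move=> i; case: (MP [set y | lt y (x i)]).
- by move=> i; apply: Mmono => y /trans; apply; case: (hx i).
- move=> i l; have [h _ _] := hc i; apply: Mmono (h l) => y.
  have [_ lti] := hx i.
  by move=> [/trans|->]; [apply|].
- by move=> i; case: (hc i).
- by move=> i; case: (hc i).
Qed.

(** * Limit types along an ultrafilter *)

Lemma ultra_list (X I : Type) (G : set_system X) (UG : UltraFilter G) (s : seq I)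
    (P : I -> set X) :
  (forall i, List.In i s -> G (P i)) -> G [set x | forall i, List.In i s -> P i x].
Proof.
elim: s => [|i s IH] h; first by apply: filterS filterT => x _ i [].
apply: filterS (filterI (h i (or_introl erefl)) (IH (fun j hj => h j (or_intror hj)))).
by move=> x [hx hs] j [<-|/hs].
Qed.

Lemma ultraP (X : Type) (G : set_system X) (UG : UltraFilter G) (P : set X) :
  ~ G P -> G (~` P).
Proof. by have [] := in_ultra_setVsetC P UG. Qed.

Lemma ultra_fin (X : Type) (I : finType) (G : set_system X) (UG : UltraFilter G)
    (P : I -> set X) : G [set x | exists i, P i x] -> exists i, G (P i).
Proof.
move=> h; apply: contrapT => n.
have H : G [set x | forall i, List.In i (enum I) -> ~ P i x].
  by apply: ultra_list => i _; apply: ultraP => hi; apply: n; exists i.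
have [x [nx [i Pi]]] := filter_ex (filterI H h).
exact: (nx i (In_enum i)).
Qed.

Lemma array_ultrafilter : exists G : set_system (nat * nat),
  [/\ UltraFilter G, forall P, G P -> exists al, infinite_set [set i | P (al, i)] &
      forall al, G [set t | t.1 != al]].
Proof.
pose F : set_system (nat * nat) := fun P => exists N, forall al, N <= al ->
  exists Ni, forall i, Ni <= i -> P (al, i).
have FF : ProperFilter F.
  split; first by move=> [N /(_ N (leqnn _))[Ni /(_ Ni (leqnn _))]].
  split.
  - by exists 0 => al _; exists 0.
  - move=> P Q [N hN] [N' hN']; exists (maxn N N') => al; rewrite geq_max => /andP[h1 h2].
    have [Ni hNi] := hN al h1; have [Ni' hNi'] := hN' al h2.
    by exists (maxn Ni Ni') => i; rewrite geq_max => /andP[/hNi ? /hNi' ?].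
  - by move=> P Q PQ [N hN]; exists N => al /hN[Ni h]; exists Ni => i /h /PQ.
have [G [UG FG]] := ultraFilterLemma FF.
exists G; split=> // [P GP|al].
  apply: contrapT => n; suff /FG nP : F (~` P).
    by apply: (@filter_not_empty _ G _); rewrite -(setICr P); exact: filterI.
  exists 0 => al _; have : finite_set [set i | P (al, i)].
    by apply: contrapT => inf; apply: n; exists al.
  move=> /finite_set_In[s hs]; exists (\max_(i <- s) i).+1 => i hi Pi.
  by move/hs/In_bigmax: Pi; rewrite leqNgt hi.
apply: FG; exists al.+1 => al' h; exists 0 => i _ /=.
by rewrite gtn_eqF.
Qed.

Lemma countably_saturated_model K L (T : theory L) (U : structure L) (hU : monster K T U)
    (a : nat -> U) : exists M : set U,
  [/\ tiny L {u | M u}, elementary_substructure M, forall i, M (a i) &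
      forall (y : nat -> U) r (e : 'I_r -> U), (forall i, M (y i)) ->
        exists2 e', forall i, M (e' i) &
          forall chi : formula L ('I_r + nat), sat chi (sumv e y) <-> sat chi (sumv e' y)].
Proof.
have [u0] := carrier_inh U.
pose join r (e : 'I_r -> U) (y : nat -> U) i := oapp e (y (i - r)) (insub i).
pose real r (l : set (formula L nat)) y (e : 'I_r -> U) :=
  forall chi, l chi <-> sat chi (join r e y).
have exf : forall z : {r : nat & (set (formula L nat) * (nat -> U))%type},
    exists e, (exists e', real (projT1 z) (projT2 z).1 (projT2 z).2 e') ->
      real (projT1 z) (projT2 z).1 (projT2 z).2 e.
  move=> [r [l y]] /=; have [[e he]|n] := pselect (exists e', real r l y e').
    by exists e.
  by exists (fun=> u0).
pose f z := sval (cid (exf z)); pose hf z := svalP (cid (exf z)).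
pose step (lab : nat * nat * set (formula L nat)) (y : nat -> U) : U :=
  oapp (f (existT _ lab.1.1 (lab.2, y))) u0 (insub lab.1.2).
pose tm := wtree nat (nat * nat * set (formula L nat)).
pose fix ev (t : tm) : U :=
  match t with Leaf i => a i | Node lab ts => step lab (fun i => ev (ts i)) end.
pose M := range ev.
have satM (y : nat -> U) r (e : 'I_r -> U) : (forall i, M (y i)) ->
        exists2 e', forall i, M (e' i) &
          forall chi : formula L ('I_r + nat), sat chi (sumv e y) <-> sat chi (sumv e' y).
  move=> /(_ _)/cid2-/all_sig2[ts _ hts].
  pose lab := [set chi | sat chi (join r e y)].
  pose e' := f (existT _ r (lab, y)).
  have he' : real r lab y e' by apply: (hf (existT _ r (lab, y))); exists e.
  exists e' => [i|chi].
    exists (Node (r, i : nat, lab) ts) => //=.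
    by rewrite /step /= valK /= (_ : (fun i => ev (ts i)) = y) //; apply/funext.
  have E (d : 'I_r -> U) : sat chi (sumv d y) =
      sat (rename chi (fun z => match z with inl i => val i | inr j => r + j end)) (join r d y).
    rewrite sat_rename; congr sat; apply/funext => -[i|j]; rewrite /join /= ?valK //.
    by rewrite insubN -?leqNgt ?leq_addr //= addKn.
  by rewrite !E -he'.
exists M; split=> //.
- apply: (tiny_sig (f := ev)) => [u [t _ <-]|]; first by exists t.
  apply: tiny_wtree; first exact: tiny_count.
  by apply: tiny_prod; [exact: tiny_count|exact: tiny_set_formula].
- apply: tarski_vaught => [|chi y u My hu]; first by exists (a 0), (Leaf 0).
  have [e Me he] := satM y 1 (fun=> u) My.
  have E d : sat chi (fun i => if i is j.+1 then y j else d ord0) =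
      sat (rename chi (fun i => if i is j.+1 then inr j else inl (ord0 : 'I_1))) (sumv d y).
    by rewrite sat_rename; congr sat; apply/funext => -[].
  by exists (e ord0) => //; rewrite E -he -E.
- by move=> i; exists (Leaf i).
Qed.

Lemma elementary_sat L (U : structure L) (A : set U) (A0 : inhabited {x : U | A x})
    (Acl : closed_under_funcs A) :
  (forall n (phi : formula L 'I_n) (v : 'I_n -> substructure A0 Acl),
      sat phi v <-> sat (M := U) phi (fun i => sval (v i))) ->
  forall (V : Type) (phi : formula L V) (v : V -> substructure A0 Acl),
    sat phi v <-> sat (M := U) phi (fun i => sval (v i)).
Proof.
move=> eA V phi v.
have [r [psi [q h]]] := formula_params (rename phi (@inr void V)).
have E (S : structure L) (w : V -> S) : sat phi w =
    sat (rename psi (fun z => match z with inl x => of_void _ x | inr i => i end)) (w \o q).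
  rewrite sat_rename (_ : _ \o _ = sumv (of_void _) (w \o q)); last by apply/funext => -[].
  by rewrite h sat_rename.
by rewrite (E U) -eA E.
Qed.

Lemma elementary_witness L (U : structure L) (A : set U) (chi : formula L nat)
    (y : nat -> {x | A x}) (u : U) : elementary_substructure A ->
  sat chi (scons u (fun j => sval (y j))) ->
  exists x : {x | A x}, sat chi (scons (sval x) (fun j => sval (y j))).
Proof.
move=> [A0 [Acl /elementary_sat eA]] hu.
pose psi := rename chi (fun i => if i is j.+1 then Some j else None).
have E (S : structure L) (x : S) (v : nat -> S) : sat psi (oapp v x) = sat chi (scons x v).
  by rewrite sat_rename; congr sat; apply/funext => -[].
have : sat (M := U) (Ex psi) (fun j => sval (y j)) by rewrite sat_Ex; exists u; rewrite E.
move/(eA _ (Ex psi) y); rewrite sat_Ex => -[x /eA hx]; exists x.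
by rewrite -E; move: hx; congr sat; apply/funext => -[].
Qed.

Lemma ultrapower_embedding K L (T : theory L) (U : structure L) (hU : monster K T U)
    (I : countType) (G : set_system I) (UG : UltraFilter G) (M : set U) :
  tiny L {u | M u} -> elementary_substructure M ->
  exists h : (I -> {u | M u}) -> U,
    [/\ forall chi, sat chi h <-> G [set t | sat chi (fun F => sval (F t))],
        forall x : {u | M u}, h (fun=> x) = sval x & elementary_substructure (range h)].
Proof.
move=> tM eM; pose V := I -> {u | M u}.
have tV : tiny L V by exact: tiny_count_fun.
have [s l hs hl|h [hG hc]] := compactness hU (R0 := [set z | exists x, z = ((fun=> x) : V, sval x)])
    (Phi := fun chi => G [set t | sat chi (fun F : V => sval (F t))]) tV.
  have /(ultra_list UG)/filter_ex[t ht] := hs.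
  exists (fun F => sval (F t)); split=> [//|z /hl[x ->] //].
have hiff chi : sat chi h <-> G [set t | sat chi (fun F => sval (F t))].
  split=> [hh|]; last exact: hG.
  by apply: contrapT => /ultraP n; exact: hG (Not chi) n hh.
have hconst (x : {u | M u}) : h (fun=> x) = sval x by apply: (hc (_, _)); exists x.
exists h; split=> //.
have [[x0] [Mcl Me]] := eM.
apply: tarski_vaught; first by exists (h (fun=> x0)), (fun=> x0).
move=> chi y u /(_ _)/cid2-/all_sig2[F _ hF] hu.
pose r i : option V := if i is j.+1 then Some (F j) else None.
have : sat (Ex (rename chi r)) h.
  rewrite sat_Ex; exists u; rewrite sat_rename; move: hu; congr sat.
  by apply/funext => -[|j] //=; rewrite hF.
move=> /hiff hG'.
have /choice[F' hF'] : forall t, exists x : {u | M u},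
    sat (Ex (rename chi r)) (fun F : V => sval (F t)) ->
    sat chi (scons (sval x) (fun j => sval (F j t))).
  move=> t; have [ht|nt] := pselect (sat (Ex (rename chi r)) (fun F : V => sval (F t))); last by exists x0.
  have [x hx] : exists x : {u | M u}, sat chi (scons (sval x) (fun j => sval (F j t))).
    move: ht; rewrite sat_Ex => -[x hx].
    apply: (elementary_witness eM (y := fun j => F j t) (u := x)).
    by move: hx; rewrite sat_rename; congr sat; apply/funext => -[].
  by exists x.
exists (h F'); first by exists F'.
have E (v : V -> U) : sat chi (scons (v F') (fun j => v (F j))) =
    sat (rename chi (fun i => if i is j.+1 then F j else F')) v.
  by rewrite sat_rename; congr sat; apply/funext => -[].
have := E h; rewrite (_ : (fun j => h (F j)) = y); last by apply/funext.
rewrite /scons => ->; apply/hiff; apply: filterS hG' => t /= /hF'.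
by have := E (fun F => sval (F t)) => /= ->.
Qed.

(* For [G]-most [t1], for [G]-most [t2], ..., the sets [Y], [S1 t1], [S2 t2],
   ... have a common point, where [l = [:: S1; S2; ...]]. *)
Fixpoint generic_meet (I X : Type) (G : set_system I) (l : seq (I -> set X)) (Y : set X) : Prop :=
  if l is A :: l' then G [set t | generic_meet G l' (Y `&` A t)] else Y !=set0.

Lemma generic_meetS (I X : Type) (G : set_system I) (FG : Filter G) (l : seq (I -> set X))
    (Y Z : set X) : Y `<=` Z -> generic_meet G l Y -> generic_meet G l Z.
Proof.
elim: l Y Z => [|S l IH] Y Z YZ /=; first by move=> [x /YZ Zx]; exists x.
by move=> h; apply: filterS h => t; apply: IH => x [/YZ].
Qed.

Lemma generic_meetU (I X J : Type) (s : seq J) (G : set_system I) (UG : UltraFilter G)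
    (l : seq (I -> set X)) (Y : J -> set X) :
  generic_meet G l [set x | exists2 j, List.In j s & Y j x] ->
  exists2 j, List.In j s & generic_meet G l (Y j).
Proof.
elim: l Y => [|S l IH] Y /=; first by move=> [x [j sj Yx]]; exists j => //; exists x.
move=> h; apply: contrapT => n.
have H : G [set t | forall j, List.In j s -> ~ generic_meet G l (Y j `&` S t)].
  by apply: ultra_list => j sj; apply: ultraP => hj; apply: n; exists j.
have [t [nt ht]] := filter_ex (filterI H h).
have [j sj hj] : exists2 j, List.In j s & generic_meet G l (Y j `&` S t).
  by apply: IH; apply: generic_meetS ht => x [[j sj Yx] Sx]; exists j.
exact: (nt j).
Qed.

Lemma generic_meet_nseq (I X : Type) (G : set_system I) (FG : ProperFilter G) (S : I -> set X)
    (Y : set X) d d' : d' <= d -> generic_meet G (nseq d S) Y -> generic_meet G (nseq d' S) Y.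
Proof.
move=> /subnK <-; elim: (d - d') => [|e IH]; first by rewrite add0n.
rewrite addSn /= => H; have [t h] := filter_ex H; apply: IH.
by apply: generic_meetS h; apply: subIsetl.
Qed.

Lemma generic_meet_color (I X : Type) (J : finType) (G : set_system I) (UG : UltraFilter G)
    (S0 : I -> set X) (S : J -> I -> set X) N (Y : set X) :
  G [set t | S0 t `<=` [set x | exists j, S j t x]] ->
  generic_meet G (nseq N S0) Y ->
  exists col : N.-tuple J, generic_meet G [seq S j | j <- col] Y.
Proof.
move=> cov; elim: N Y => [|N IH] Y /=; first by exists [tuple].
move=> h; have [[j col] hjc] : exists z : J * N.-tuple J,
    G [set t | generic_meet G [seq S j | j <- z.2] (Y `&` S z.1 t)].
  apply: ultra_fin; apply: filterS (filterI cov h) => t [covt ht].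
  have [j _ /IH[col hcol]] : exists2 j, List.In j (enum J) &
      generic_meet G (nseq N S0) (Y `&` S j t).
    apply: generic_meetU; apply: generic_meetS ht => x [Yx /covt[j Sx]].
    by exists j; [exact: In_enum|].
  by exists (j, col).
by exists [tuple of j :: col].
Qed.

Lemma generic_meet_count (I X : Type) (J : eqType) (G : set_system I) (FG : ProperFilter G)
    (S : J -> I -> set X) (s : seq J) (j : J) (Y : set X) :
  generic_meet G [seq S i | i <- s] Y -> generic_meet G (nseq (count_mem j s) (S j)) Y.
Proof.
elim: s Y => //= i s IH Y; have [->|_] := eqVneq i j => h.
  by apply: filterS h => t; exact: IH.
by have [t /IH ht] := filter_ex h; apply: generic_meetS ht; exact: subIsetl.
Qed.

Lemma sum_count_mem (J : finType) (s : seq J) : \sum_j count_mem j s = size s.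
Proof.
elim: s => [|i s IH] /=; first by rewrite big1.
rewrite big_split /= IH (bigD1 i) //= eqxx big1 ?addn0 // => j ji.
by rewrite eq_sym (negbTE ji).
Qed.

Lemma generic_meet_pigeonhole (I X : Type) (J : finType) (G : set_system I)
    (UG : UltraFilter G) (S0 : I -> set X) (S : J -> I -> set X) :
  G [set t | S0 t `<=` [set x | exists j, S j t x]] ->
  (forall N, generic_meet G (nseq N S0) setT) ->
  exists j, forall N, generic_meet G (nseq N (S j)) setT.
Proof.
move=> cov h; apply: contrapT => n.
have /choice[d hd] : forall j, exists d, ~ generic_meet G (nseq d (S j)) setT.
  by move=> j; apply: contrapT => nj; apply: n; exists j => N; apply: contrapT => nN; apply: nj; exists N.
have [col hcol] := generic_meet_color UG cov (h (\sum_j d j).+1).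
have : \sum_j count_mem j col <= \sum_j d j.
  apply: leq_sum => j _; rewrite leqNgt; apply/negP => /ltnW lt.
  by apply: (hd j); apply: generic_meet_nseq lt _; exact: generic_meet_count.
by rewrite sum_count_mem size_tuple ltnn.
Qed.

(* [e] realizes over [B] the limit along [G] of the types of the tuples [F t]. *)
Definition realizes_limit L (U : structure L) (I : Type) (G : set_system I) m
    (F : I -> 'I_m -> U) (B : set U) (e : 'I_m -> U) : Prop :=
  forall (V : Type) (theta : formula L ('I_m + V)) (p : V -> U), (forall x, B (p x)) ->
    G [set t | sat theta (sumv (F t) p)] -> sat theta (sumv e p).

Definition solutions L (U : structure L) n m (psi : formula L ('I_n + 'I_m))
    (l : seq ('I_m -> U)) : set ('I_n -> U) :=
  [set x | forall y, List.In y l -> sat2 psi x y].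

Lemma generic_meet_limit L (U : structure L) (I : Type) (G : set_system I)
    (FG : ProperFilter G) n m (psi : formula L ('I_n + 'I_m)) (F : I -> 'I_m -> U)
    (B : set U) (e : 'I_m -> U) d l :
  realizes_limit G F B e -> (forall t i, B (F t i)) ->
  (forall y, List.In y l -> forall i, B (y i)) ->
  generic_meet G (nseq d.+1 (fun t x => sat2 psi x (F t))) (solutions psi l) ->
  generic_meet G (nseq d (fun t x => sat2 psi x (F t))) (solutions psi (e :: l)).
Proof.
move=> he FB; elim: d l => [|d IH] l lB /=.
  move=> h; pose V := ('I_(size l) * 'I_m)%type.
  pose sel i (z : 'I_n + 'I_m) : 'I_n + ('I_m + V) :=
    match z with inl j => inl j | inr j => inr (oapp (fun i => inr (i, j)) (inl j) i) end.
  have [th hth] := ex_closure (V1 := 'I_n) (V2 := 'I_m + V)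
    (Conj (rename psi (sel None)) (Conjs (List.map (fun i => rename psi (sel (Some i))) (enum 'I_(size l))))).
  pose p (z : V) := tnth (in_tuple l) z.1 z.2.
  have E y : sat th (sumv y p) <-> exists x, sat2 psi x y /\ solutions psi l x.
    rewrite hth; split=> -[x].
      rewrite sat_Conj sat_Conjs_map sat_rename => -[h1 h2]; exists x; split.
        by move: h1; rewrite /sat2; congr sat; apply/funext => -[].
      move=> z /In_tnth[i <-]; have := h2 i; rewrite sat_rename /sat2.
      by congr sat; apply/funext => -[].
    move=> [h1 h2]; exists x; rewrite sat_Conj sat_Conjs_map sat_rename; split.
      by move: h1; rewrite /sat2; congr sat; apply/funext => -[].
    move=> i; rewrite sat_rename.
    have : sat2 psi x (tnth (in_tuple l) i) by apply: h2; apply/In_tnth; exists i.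
    by rewrite /sat2; congr sat; apply/funext => -[].
  have /E[x [h1 h2]] : sat th (sumv e p).
    apply: he => [z|]; first by apply: lB; apply/In_tnth; exists z.1.
    by apply: filterS h => t [x [h2 h1]]; apply/E; exists x.
  by exists x => y [<-|/h2].
move=> h; apply: filterS h => t ht.
have : generic_meet G (nseq d (fun t x => sat2 psi x (F t))) (solutions psi (e :: F t :: l)).
  apply: IH; first by move=> y [<-|/lB//] i.
  rewrite /= in ht; apply: (@generic_meetS _ _ G _ (nseq d.+1 (fun t x => sat2 psi x (F t))) _ _ _ ht).
  by move=> x [h1 h2] y [<-|/h1].
apply: generic_meetS => x hx; split; last by apply: hx; right; left.
by move=> y [<-|hy]; apply: hx; [left|right; right].
Qed.

Lemma generic_rows L (U : structure L) (I : Type) (G : set_system I)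
    (FG : ProperFilter G) n m (psi : formula L ('I_n + 'I_m)) (F : I -> 'I_m -> U) k
    (M : set U) :
  (forall N, generic_meet G (nseq N (fun t x => sat2 psi x (F t))) setT) ->
  tiny L {u | M u} -> (forall t i, M (F t i)) ->
  (forall B : set U, tiny L {u | B u} -> M `<=` B ->
    exists e : nat -> 'I_m -> U, (forall j, realizes_limit G F B (e j)) /\
      k_inconsistent k (fun j => Inst psi (e j))) ->
  forall r, exists E : nat -> nat -> 'I_m -> U,
    (forall i, i < r -> k_inconsistent k (fun j => Inst psi (E i j))) /\
    forall f : nat -> nat, exists x, forall i, i < r -> sat2 psi x (E i (f i)).
Proof.
move=> gen tM MF ext r.
suff /(_ 0)[E [h1 h2]] : forall d, exists E : nat -> nat -> 'I_m -> U,
    (forall i, i < r -> k_inconsistent k (fun j => Inst psi (E i j))) /\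
    forall f : nat -> nat, generic_meet G (nseq d (fun t x => sat2 psi x (F t)))
      (solutions psi [seq E i (f i) | i <- iota 0 r]).
  exists E; split=> // f; have [x hx] := h2 f; exists x => i ir; apply: hx.
  apply/List.in_map_iff; exists i; split=> //.
  by apply/In_mem; rewrite mem_iota.
elim: r => [|r IH] d.

  have [u0] := carrier_inh U.
  exists (fun _ _ _ => u0); split=> // f; by apply: generic_meetS (gen d) => x _ y [].
have [E [h1 h2]] := IH d.+1.
pose B := M `|` [set u | exists z : nat * nat * 'I_m, E z.1.1 z.1.2 z.2 = u].
have [||e [he ke]] := ext B; last first.
- exists (fun i => if i == r then e else E i); split=> [i|f].
    by rewrite ltnS leq_eqVlt; case: eqP => //= _; exact: h1.
  rewrite (_ : map _ (iota 0 r.+1) = rcons [seq E i (f i) | i <- iota 0 r] (e (f r))); last first.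
    rewrite -addn1 iotaD map_cat /= add0n eqxx cats1; congr rcons.
    apply/eq_in_map => i; rewrite mem_iota add0n => /andP[_ ir].
    by rewrite ltn_eqF.
  have h : generic_meet G (nseq d (fun t x => sat2 psi x (F t)))
      (solutions psi (e (f r) :: [seq E i (f i) | i <- iota 0 r])).
    apply: (generic_meet_limit FG (he (f r)) _ _ (h2 f)); first by move=> t i; left.
    by move=> y /List.in_map_iff[i [<- _]] l; right; exists (i, f i, l).
  by apply: generic_meetS h => x hx y; rewrite -cats1 => /List.in_app_iff[h|[<-|//]]; apply: hx; [right|left].
- by move=> u Mu; left.
- pose g (z : {u | M u} + nat * nat * 'I_m) : U :=
    match z with inl u => sval u | inr z => E z.1.1 z.1.2 z.2 end.
  apply: (tiny_sig (f := g)); last by apply: tiny_sum => //; exact: tiny_count.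
  by move=> u [Mu|[z <-]]; [exists (inl (exist _ u Mu))|exists (inr z)].
Qed.

Lemma limit_sequence K L (T : theory L) (U : structure L) (hU : monster K T U)
    (I : Type) (G : set_system I) m (F : I -> 'I_m -> U) n
    (psi : formula L ('I_n + 'I_m)) k (B : set U) :
  tiny L {u | B u} ->
  (forall (s : seq (formula L ('I_m + {u | B u}))) J,
    (forall th, List.In th s -> G [set t | sat th (sumv (F t) sval)]) ->
    exists d : nat -> 'I_m -> U,
      (forall th, List.In th s -> forall j, j < J -> sat th (sumv (d j) sval)) /\
      forall g : 'I_k -> nat, injective g -> (forall i, g i < J) ->
        ~ exists b, forall i, sat2 psi b (d (g i))) ->
  exists e : nat -> 'I_m -> U, (forall j, realizes_limit G F B (e j)) /\
    k_inconsistent k (fun j => Inst psi (e j)).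
Proof.
move=> tB fin; have [chi hchi] := common_solution_formula psi k.
pose ren j (z : 'I_m + {u | B u}) : nat * 'I_m + {u | B u} :=
  match z with inl l => inl (j, l) | inr x => inr x end.
pose Phi p := (exists j th, G [set t | sat th (sumv (F t) sval)] /\ p = rename th (ren j)) \/
  exists2 g : 'I_k -> nat, injective g & p = Not (rename chi (fun z => inl (g z.1, z.2))).
have [|||w hw] := compactness_over (V1 := nat * 'I_m) (v := @sval U B) (Phi := Phi) hU.
- exact: tiny_count.
- exact: tB.
- move=> s hs.
  have [Th [J [hTh hJ]]] : exists Th J,
      (forall th, List.In th Th -> G [set t | sat th (sumv (F t) sval)]) /\
      forall p, List.In p s -> (exists j th, [/\ List.In th Th, j < J & p = rename th (ren j)]) \/
        exists g : 'I_k -> nat, [/\ injective g, forall i, g i < J &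
          p = Not (rename chi (fun z => inl (g z.1, z.2)))].
    elim: s hs => [|p s IH] hs; first by exists [::], 0.
    have [|Th [J [hTh hJ]]] := IH; first by move=> q hq; apply: hs; right.
    have [[j [th [Gth ep]]]|[g gi ep]] := hs p (or_introl erefl).
      exists (th :: Th), (maxn j.+1 J); split; first by move=> q [<-|/hTh].
      move=> q [<-|/hJ[[i [th' [h1 h2 h3]]]|[g [h1 h2 h3]]]].
      - by left; exists j, th; split=> //; [left|rewrite leq_max ltnSn].
      - by left; exists i, th'; split=> //; [right|rewrite leq_max h2 orbT].
      - by right; exists g; split=> // i; rewrite leq_max h2 orbT.
    exists Th, (maxn (\max_i g i).+1 J); split=> // q.
    move=> [<-|/hJ[[i [th' [h1 h2 h3]]]|[g' [h1 h2 h3]]]].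
    - by right; exists g; split=> // i; rewrite leq_max ltnS leq_bigmax.
    - by left; exists i, th'; split=> //; rewrite leq_max h2 orbT.
    - by right; exists g'; split=> // i; rewrite leq_max h2 orbT.
  have [d [hd kd]] := fin Th J hTh.
  exists (fun z => d z.1 z.2) => p /hJ[[j [th [hth jJ ->]]]|[g [gi gJ ->]]].
    by rewrite sat_rename; have := hd th hth j jJ; congr sat; apply/funext => -[].
  by rewrite sat_Not sat_rename => /hchi; exact: kd g gi gJ.
exists (fun j l => w (j, l)); split=> [j V th p Bp Gth|].
  pose p' x : {u | B u} := exist _ (p x) (Bp x).
  pose th' := rename th (fun z => match z with inl l => inl l | inr x => inr (p' x) end).
  have E y : sat th' (sumv y sval) = sat th (sumv y p).
    by rewrite sat_rename; congr sat; apply/funext => -[].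
  have /hw : Phi (rename th' (ren j)).
    left; exists j, th'; split=> //; move: Gth; congr G.
    by apply/seteqP; split=> t /=; rewrite E.
  rewrite sat_rename -E; congr sat.
  by apply/funext => -[].
apply/(k_inconsistentE psi (fun j l => w (j, l))) => g gi [b hb].
have : Phi (Not (rename chi (fun z => inl (g z.1, z.2)))) by right; exists g.
by move/hw; rewrite sat_Not sat_rename; apply; apply/hchi; exists b.
Qed.

(* The limit type is an heir of its restriction to [M], because the points of
   the tuples [F t] are countably many and [M] is countably saturated: a
   parameter in [B] can be moved into [M] without changing its type over them. *)
Lemma dividing_over_extension K L (T : theory L) (U : structure L) (hU : monster K T U)
    (I : countType) (G : set_system I) (UG : UltraFilter G) m (F : I -> 'I_m -> U) n
    (psi : formula L ('I_n + 'I_m)) (M : set U) (c : 'I_m -> U) (B : set U) k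
    (d : nat -> 'I_m -> U) :
  M !=set0 ->
  (forall (y : nat -> U) r (e : 'I_r -> U), (forall i, M (y i)) ->
    exists2 e', forall i, M (e' i) &
      forall chi : formula L ('I_r + nat), sat chi (sumv e y) <-> sat chi (sumv e' y)) ->
  (forall t i, M (F t i)) -> realizes_limit G F M c ->
  (forall j, same_type M (d j) c) -> k_inconsistent k (fun j => Inst psi (d j)) ->
  tiny L {u | B u} ->
  exists e : nat -> 'I_m -> U, (forall j, realizes_limit G F B (e j)) /\
    k_inconsistent k (fun j => Inst psi (e j)).
Proof.
move=> [x0 Mx0] satM MF hc hd /(k_inconsistentE psi d) kd tB.
apply: (limit_sequence hU) => // s J hs.
have [r [q [f hf]]] := finite_params s.
pose e i := sval (q i).
pose y i := if @unpickle (I * 'I_m)%type i is Some z then F z.1 z.2 else x0.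
have [|e' Me' ee'] := satM y r e.
  by move=> i; rewrite /y; case: unpickle.
have ee'0 (chi : formula L 'I_r) : sat chi e <-> sat chi e'.
  have E v : sat chi v = sat (rename chi (@inl 'I_r nat)) (sumv v y).
    by rewrite sat_rename; congr sat.
  by rewrite !E; exact: ee'.
have ee't t (th : formula L ('I_m + 'I_r)) : sat th (sumv (F t) e) <-> sat th (sumv (F t) e').
  have E v : sat th (sumv (F t) v) = sat (rename th (fun z => match z with
      inl l => inr (pickle (t, l)) | inr i => inl i end)) (sumv v y).
    rewrite sat_rename; congr sat; apply/funext => -[l|i] //=.
    by rewrite /y pickleK.
  by rewrite !E; exact: ee'.
have [chi hchi] := common_solution_formula psi k.
pose ren (j : 'I_J) (z : 'I_m + {u | B u}) : 'I_J * 'I_m + 'I_r :=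
  match z with inl l => inl (j, l) | inr x => inr (f x) end.
pose incons (g : {ffun 'I_k -> 'I_J}) : formula L ('I_J * 'I_m + 'I_r) :=
  if injectiveb g then Not (rename chi (fun z => inl (g z.1, z.2))) else Not Bot.
have [sg hsg] := ex_closure (Conj
  (Conjs (List.map (fun j => Conjs (List.map (fun th => rename th (ren j)) s)) (enum 'I_J)))
  (Conjs (List.map incons (enum {ffun 'I_k -> 'I_J})))).
have sgE (v : 'I_r -> U) : sat sg v <-> exists w : 'I_J * 'I_m -> U,
    (forall j th, List.In th s -> sat th (sumv (fun l => w (j, l)) (v \o f))) /\
    forall g : 'I_k -> 'I_J, injective g -> ~ exists b, forall i, sat2 psi b (fun l => w (g i, l)).
  have renE w j th : sat (rename th (ren j)) (sumv w v) = sat th (sumv (fun l => w (j, l)) (v \o f)).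
    by rewrite sat_rename; congr sat; apply/funext => -[].
  rewrite hsg; split=> -[w].
    rewrite sat_Conj !sat_Conjs_map => -[h1 h2]; exists w; split=> [j th hth|g gi].
      have := h1 j; rewrite sat_Conjs -renE; apply.
      by apply/List.in_map_iff; exists th.
    have := h2 (finfun g); rewrite /incons ifT; last first.
      by apply/injectiveP => i i'; rewrite !ffunE => /gi.
    rewrite sat_Not sat_rename => h [b hb]; apply: h; apply/hchi; exists b => i.
    by have := hb i; congr sat2; apply/funext => l /=; rewrite ffunE.
  move=> [h1 h2]; exists w; rewrite sat_Conj !sat_Conjs_map; split=> [j|g].
    rewrite sat_Conjs => p /List.in_map_iff[th [<- hth]].
    by rewrite renE; exact: h1.
  rewrite /incons; case: injectiveP => gi; last by move=> [].
  by rewrite sat_Not sat_rename => /hchi; exact: h2.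
have : sat sg e'.
  apply/sgE; exists (fun z => d (val z.1) z.2); split=> [j th hth|g gi]; last first.
    exact: (kd (fun i => val (g i)) (inj_comp val_inj gi)).
  apply/(same_type_sat th (hd j) (fun x => Me' (f x))).
  apply: hc => [x|]; first exact: Me'.
  apply: filterS (hs th hth) => t /=; rewrite -(hf th hth).
  have E v : sat th (sumv (F t) (v \o f)) = sat (rename th (fun z => match z with
      inl l => inl l | inr x => inr (f x) end)) (sumv (F t) v).
    by rewrite sat_rename; congr sat; apply/funext => -[].
  by rewrite -[_ \o f]/(e \o f) !E => /ee't.
move/ee'0/sgE => [w [h1 h2]].
have [J0|J0] := posnP J.
  exists d; split=> [th _ j|g gi gJ]; first by rewrite J0.
  exact: kd.
pose jo j : 'I_J := insubd (Ordinal J0) j.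
exists (fun j l => w (jo j, l)); split=> [th hth j jJ|g gi gJ].
  by rewrite -(hf th hth); exact: h1.
apply: (h2 (fun i => jo (g i))) => i i' /(congr1 val).
by rewrite !val_insubd !gJ => /gi.
Qed.

(** * From arrays to the independence property *)

Definition fupd (R : finType) (V : Type) (g : {ffun R -> V}) r v : {ffun R -> V} :=
  [ffun s => if s == r then v else g s].

Lemma card_bad_le (R V : finType) (bad : pred {ffun R -> V}) (r : R) k :
  (forall g, #|[pred v | bad (fupd g r v)]| <= k) ->
  #|bad| * #|V| <= #|{ffun R -> V}| * k.
Proof.
move=> hk; pose A := [pred z : {ffun R -> V} * V | bad (fupd z.1 r z.2)].
have cA : #|A| <= #|{ffun R -> V}| * k.
  rewrite -sum1_card (eq_bigl (fun z : {ffun R -> V} * V => xpredT z.1 && bad (fupd z.1 r z.2))) //.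
  rewrite -(pair_big_dep xpredT (fun g v => bad (fupd g r v)) (fun _ _ => 1)) /=.
  rewrite -sum_nat_const; apply: leq_sum => g _.
  by rewrite sum1_card; exact: hk.
apply: leq_trans cA.
pose f (z : {ffun R -> V} * V) := (fupd z.1 r z.2, z.1 r).
have fK : cancel f f.
  move=> [g v]; rewrite /f /= ffunE eqxx; congr pair.
  by apply/ffunP => s; rewrite !ffunE; case: eqP => [->|].
rewrite -cardX -(card_imset _ (can_inj fK)); apply: subset_leq_card.
apply/fintype.subsetP => z /imsetP[[g v] /andP[/= bg _] ->]; rewrite inE /f /=.
suff -> : fupd (fupd g r v) r (g r) = g by [].
by apply/ffunP => s; rewrite !ffunE; case: eqP => [->|].
Qed.

(* A random [g] works: for each [i] and [r] it is bad with probability at most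
   [k / #|V|]. *)
Lemma avoid_bad (I R V : finType) (bad : I -> R -> pred {ffun R -> V}) k :
  (forall i r g, #|[pred v | bad i r (fupd g r v)]| <= k) ->
  #|I| * #|R| * k < #|V| -> exists g, forall i r, ~~ bad i r g.
Proof.
move=> hk hV; apply: contrapT => n.
have /card_gt0P[v0 _] : 0 < #|V| by exact: leq_ltn_trans hV.
have pos : 0 < #|{ffun R -> V}| by apply/card_gt0P; exists [ffun=> v0].
have cov : #|{ffun R -> V}| <= \sum_i \sum_r #|bad i r|.
  have -> : \sum_i \sum_r #|bad i r| = \sum_(z : I * R) #|bad z.1 z.2|.
    by rewrite pair_bigA.
  rewrite (eq_bigr (fun z : I * R => \sum_(g : {ffun R -> V}) (bad z.1 z.2 g : nat))); last first.
    by move=> z _; rewrite -sum1_card big_mkcond.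
  rewrite exchange_big -sum1_card; apply: leq_sum => g _ /=.
  have [i [r hir]] : exists i r, bad i r g.
    apply: contrapT => h; apply: n; exists g => i r; apply/negP => b; apply: h; by exists i, r.
  by rewrite (bigD1 (i, r)) //= hir.
have : #|{ffun R -> V}| * #|V| <= #|{ffun R -> V}| * (#|I| * #|R| * k).
  apply: leq_trans (leq_mul cov (leqnn _)) _.
  have h1 i r : #|bad i r| * #|V| <= #|{ffun R -> V}| * k by apply: card_bad_le; exact: hk.
  rewrite big_distrl /=; under eq_bigr do rewrite big_distrl /=.
  apply: (@leq_trans (\sum_(i : I) \sum_(r : R) #|{ffun R -> V}| * k)).
    by apply: leq_sum => i _; apply: leq_sum => r _; exact: h1.
  rewrite (eq_bigr (fun=> #|R| * (#|{ffun R -> V}| * k))) => [|i _]; last by rewrite sum_nat_const.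
  by rewrite sum_nat_const !mulnA [_ * #|{ffun R -> V}|]mulnC !mulnA.
by rewrite leq_pmul2l // leqNgt hV.
Qed.

Lemma finite_shattering L (U : structure L) n m (psi : formula L ('I_n + 'I_m)) k :
  (forall r, exists E : nat -> nat -> 'I_m -> U,
    (forall i, i < r -> k_inconsistent k (fun j => Inst psi (E i j))) /\
    forall f : nat -> nat, exists x, forall i, i < r -> sat2 psi x (E i (f i))) ->
  forall N, exists (a : 'I_N -> 'I_n -> U) (b : {set 'I_N} -> 'I_m -> U),
    forall i s, sat2 psi (a i) (b s) <-> i \in s.
Proof.
move=> rows N; pose R : finType := {set 'I_N}; pose J := (#|'I_N| * #|R| * k).+1.
have [E [kE /choice[x hx]]] := rows #|R|.
pose path (i : 'I_N) (g : {ffun R -> 'I_J}) (p : nat) : nat :=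
  if [pick r : R | enum_rank r == p :> nat] is Some r then
    if i \in (r : {set 'I_N}) then val (g r) else 0 else 0.
have pathE i g (r : R) : path i g (enum_rank r) = if i \in (r : {set 'I_N}) then val (g r) else 0.
  rewrite /path; case: pickP => [r' /eqP/val_inj/enum_rank_inj->//|/(_ r)].
  by rewrite eqxx.
pose bad i (r : R) (g : {ffun R -> 'I_J}) : bool :=
  (i \notin (r : {set 'I_N})) && `[< sat2 psi (x (path i g)) (E (enum_rank r) (g r)) >].
have [g hg] : exists g, forall i r, ~~ bad i r g.
  apply: (@avoid_bad _ _ _ _ k); last by rewrite [X in _ < X]card_ord.
  move=> i r g; rewrite leqNgt; apply/negP => hk.
  have ir : i \notin (r : {set 'I_N}).
    apply/negP => ir; move: hk; rewrite (eq_card0 (A := [pred v | _])) // => v.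
    by rewrite !inE /bad ir.
  have pathU v : path i (fupd g r v) = path i g.
    apply/funext => p; rewrite /path; case: pickP => // q _; case: ifP => // iq.
    by rewrite ffunE; case: eqP => // e; rewrite -e iq in ir.
  pose A := [pred v | bad i r (fupd g r v)].
  have hA v : v \in A -> sat2 psi (x (path i g)) (E (enum_rank r) v).
    by rewrite inE => /andP[_ /asboolP]; rewrite pathU ffunE eqxx.
  have := kE (enum_rank r) (ltn_ord _).
  move/(k_inconsistentE psi (E (enum_rank r)))/(_ (fun l => val (enum_val (widen_ord (ltnW hk) l)))).
  apply; first by move=> l l' /val_inj/enum_val_inj/(congr1 val) /= /ord_inj.
  exists (x (path i g)) => l; apply: hA; exact: enum_valP.
exists (fun i => x (path i g)), (fun s => E (enum_rank s) (g s)) => i s; split=> [h|h].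
  by apply/negP => /negP ns; have := hg i s; rewrite /bad ns /= => /asboolP.
by have := hx (path i g) (enum_rank s) (ltn_ord _); rewrite pathE h.
Qed.

Lemma independence_of_shattering K L (T : theory L) (U : structure L) (hU : monster K T U)
    n m (psi : formula L ('I_n + 'I_m)) :
  (forall N, exists (a : 'I_N -> 'I_n -> U) (b : {set 'I_N} -> 'I_m -> U),
    forall i s, sat2 psi (a i) (b s) <-> i \in s) ->
  has_independence_property U psi.
Proof.
move=> fin; pose V := (nat * 'I_n + set nat * 'I_m)%type.
have tV : tiny L V.
  apply: tiny_sum; first exact: tiny_count.
  apply: tiny_prod; last exact: tiny_count.
  have := tiny_fun (tiny_set_formula L).
  apply: (tiny_inj (f := fun (s : set nat) i => [set phi : formula L nat | s i])) => s s' e.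
  by apply/funext => i; exact: (congr1 (fun F : nat -> set (formula L nat) => F i Bot) e).
pose inst i s : formula L V :=
  rename psi (fun z => match z with inl l => inl (i, l) | inr l => inr (s, l) end).
pose Phi p := exists i s, p = if `[< s i >] then inst i s else Not (inst i s).
have [s l hs hl|v [hv _]] := compactness hU (R0 := set0) (Phi := Phi) tV.
  have [N hN] : exists N, forall p, List.In p s ->
      exists2 i, i < N & exists s, p = if `[< s i >] then inst i s else Not (inst i s).
    elim: s hs => [|p s IH] hs; first by exists 0.
    have [|N hN] := IH; first by move=> q hq; apply: hs; right.
    have [i [A ep]] := hs p (or_introl erefl).
    exists (maxn i.+1 N) => q [<-|/hN[j jN [A' eq]]].
      by exists i; [rewrite leq_max ltnSn|exists A].
    by exists j; [rewrite leq_max jN orbT|exists A'].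
  have [a [b hab]] := fin N; have [u0] := carrier_inh U.
  pose tr (A : set nat) : {set 'I_N} := [set j : 'I_N | `[< A j >]]%SET.
  pose v (z : V) : U := match z with
    | inl z => oapp (fun i => a i z.2) u0 (insub z.1) | inr z => b (tr z.1) z.2 end.
  exists v; split=> [p /hN[i iN [A ->]]|z /hl //].
  have E : sat (inst i A) v <-> A i.
    have -> : sat (inst i A) v = sat2 psi (a (Ordinal iN)) (b (tr A)).
      rewrite sat_rename /sat2; congr sat; apply/funext => -[j|j] //=.
      by rewrite insubT.
    rewrite hab inE; split; by [move/asboolP|move=> ?; apply/asboolP].
  by case: asboolP => h; [apply/E|rewrite sat_Not E].
exists (fun i l => v (inl (i, l))), (fun s l => v (inr (s, l))) => i s.
have -> : sat2 psi (fun l => v (inl (i, l))) (fun l => v (inr (s, l))) = sat (inst i s) v.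
  by rewrite sat_rename /sat2; congr sat; apply/funext => -[].
have : Phi (if `[< s i >] then inst i s else Not (inst i s)) by exists i, s.
by move/hv; case: asboolP => h; rewrite ?sat_Not.
Qed.

Lemma generic_meet_array L (U : structure L) n m (phi : formula L ('I_n + 'I_m))
    (a : nat -> nat -> 'I_m -> U) (G : set_system (nat * nat)) (UG : UltraFilter G) :
  (forall f : nat -> nat, consistent (range (fun al => Inst phi (a al (f al))))) ->
  (forall al, G [set t | t.1 != al]) ->
  forall N, generic_meet G (nseq N (fun t x => sat2 phi x (a t.1 t.2))) setT.
Proof.
move=> cons rows N.
suff H : forall ts : seq (nat * nat), uniq (map fst ts) ->
    generic_meet G (nseq N (fun t x => sat2 phi x (a t.1 t.2)))
      [set x | forall t, List.In t ts -> sat2 phi x (a t.1 t.2)].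
  by apply: generic_meetS (H [::] erefl).
elim: N => [|N IH] ts uts.
  pose f al := nth 0 (map snd ts) (index al (map fst ts)).
  have fE t : List.In t ts -> f t.1 = t.2.
    rewrite /f; elim: ts uts {f} => //= s ts IH /andP[ns uts] [<-|ht]; first by rewrite eqxx.
    case: eqP => [e|_]; last exact: IH.
    by case/negP: ns; rewrite e; apply: map_f; apply/In_mem.
  have /(consistent_range phi (fun al => _))/(_ (map fst ts))[x hx] := cons f.
  exists x => t ht; have := hx t.1; rewrite fE //; apply.
  by apply/List.in_map_iff; exists t.
have : G [set t | forall al, List.In al (map fst ts) -> t.1 != al].
  by apply: ultra_list => al _; exact: rows.
move=> h; apply: filterS h => t ht.
have ut : uniq (map fst (t :: ts)).
  by rewrite /= uts andbT; apply/negP => /In_mem/ht; rewrite eqxx.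
by apply: generic_meetS (IH _ ut) => x hx; split=> [s hs|]; apply: hx; [right|left].
Qed.

Lemma ultrapower_limit L (U : structure L) (I : Type) (G : set_system I) (M : set U)
    (h : (I -> {u | M u}) -> U) m (F : 'I_m -> I -> {u | M u})
    (V : Type) (theta : formula L ('I_m + V)) (p : V -> U) :
  (forall chi, sat chi h <-> G [set t | sat chi (fun F => sval (F t))]) ->
  (forall x : {u | M u}, h (fun=> x) = sval x) -> (forall x, M (p x)) ->
  sat theta (sumv (h \o F) p) <-> G [set t | sat theta (sumv (fun l => sval (F l t)) p)].
Proof.
move=> hh hc Mp.
pose r (z : 'I_m + V) : I -> {u | M u} :=
  match z with inl l => F l | inr x => fun=> exist _ (p x) (Mp x) end.
have -> : sat theta (sumv (h \o F) p) = sat (rename theta r) h.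
  by rewrite sat_rename; congr sat; apply/funext => -[l|x] //=; rewrite hc.
rewrite hh; suff -> : [set t | sat (rename theta r) (fun F => sval (F t))] =
    [set t | sat theta (sumv (fun l => sval (F l t)) p)] by [].
apply/seteqP; split=> t /=; rewrite sat_rename; congr sat; by apply/funext => -[].
Qed.

Lemma dependent_dividing_NTP2 K L (T : theory L) (U : structure L) (hU : monster K T U) :
  dependent_dividing U K -> NTP2 U.
Proof.
move=> dd n m phi [a [inc cons]].
have [G [UG Grow Gcol]] := array_ultrafilter; have [u0] := carrier_inh U.
pose I := (nat * nat)%type.
have [M [tM eM Ma satM]] := countably_saturated_model hU
  (fun i => if @unpickle (I * 'I_m)%type i is Some z then a z.1.1 z.1.2 z.2 else u0).
have {}Ma (t : I) l : M (a t.1 t.2 l) by have := Ma (pickle (t, l)); rewrite pickleK.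
have [h [hh hc eN]] := ultrapower_embedding hU UG tM eM.
pose A (l : 'I_m) (t : I) : {u | M u} := exist _ _ (Ma t l).
pose b := h \o A; pose N := range h.
have MN : M `<=` N by move=> u Mu; exists (fun=> exist _ u Mu) => //; rewrite hc.
have tV : tiny L (I -> {u | M u}) by exact: tiny_count_fun.
have tN : tiny L {u | N u} by apply: (tiny_sig (f := h)) tV => u [F _ <-]; exists F.
have divb : divides M (Inst phi b).
  have [e [he ke]] : exists e : nat -> 'I_m -> U,
      (forall j, realizes_limit G (fun t => a t.1 t.2) M (e j)) /\
      k_inconsistent 2 (fun j => Inst phi (e j)).
    apply: (limit_sequence hU) => // s J hs.
    have [al /infinite_nat_enum[f [fi hf]]] := Grow _ (ultra_list UG hs).
    exists (fun j => a al (f j)); split=> [th hth j _|g gi _]; first exact: (hf j th hth).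
    by have /(k_inconsistentE phi (a al))/(_ (f \o g)) := inc al; apply; exact: inj_comp.
  exists 2, e; split=> [j|//].
  suff H : same_type M b (e j) by move=> th oth; exact: iff_sym (H th oth).
  apply: same_type_of_imp => -[r th p] oth /(ultrapower_limit (p := p) A th hh hc) H.
  by apply: he => //; apply: H.
pose bad (th : pformula U n) :=
  [/\ dependent_formula U (pf_formula th), over N th & divides M th].
pose Phi : set (pformula U n) := [set th | th = Inst phi b \/ exists2 th', bad th' & th = pnot th'].
have [Pc|nPc] := pselect (consistent Phi).
  have [th [->|[th' [_ oth' _] ->]]|x hx] := saturation hU (g := h) tV _ Pc.
  - by move=> l; exists (A l).
  - exact: oth'.
  have [|r [psi [c [dpsi Nc [_ pc] dc]]]] := dd M N (small_model_of_tiny hU tM eM)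
      (small_model_of_tiny hU tN eN) MN n (type_of N x) (complete_type_of _ _).
    exists (Inst phi b); split=> // x' hx'; apply: hx'; split; last by apply: hx; left.
    by move=> l; exists (A l).
  have : psat x (pnot (Inst psi c)) by apply: hx; right; exists (Inst psi c).
  by apply.
have [bs [bbs cov]] : exists bs, (forall th, List.In th bs -> bad th) /\
    forall x, psat x (Inst phi b) -> exists2 th, List.In th bs & psat x th.
  apply: contrapT => nbs; apply: nPc; apply/consistentP => s hs.
  have [bs [bbs hbs]] : exists bs, (forall th, List.In th bs -> bad th) /\
      forall x, psat x (Inst phi b) -> (forall th, List.In th bs -> ~ psat x th) ->
        forall th, List.In th s -> psat x th.
    elim: s hs => [|th s IH] hs; first by exists [::].
    have [|bs [bbs hbs]] := IH; first by move=> q hq; apply: hs; right.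
    have [->|[th' bth' ->]] := hs th (or_introl erefl).
      exists bs; split=> // x hx1 hx2 q [<-//|]; exact: hbs.
    exists (th' :: bs); split=> [q [<-|/bbs]//|x hx1 hx2 q [<-|hq]].
      exact: hx2 th' (or_introl erefl).
    by apply: hbs hq => // q' hq'; apply: hx2; right.
  apply: contrapT => nx; apply: nbs; exists bs; split=> // x hx.
  apply: contrapT => nth; apply: nx; exists x; apply: hbs => // th hth pth.
  by apply: nth; exists th.
pose th (j : 'I_(size bs)) := tnth (in_tuple bs) j.
have bth j : bad (th j) by apply: bbs; apply/In_tnth; exists j.
have exF j : exists F : 'I_(pf_arity (th j)) -> I -> {u | M u}, forall l, h (F l) = pf_params (th j) l.
  have [_ oth _] := bth j.
  have /choice[F hF] : forall l, exists F : I -> {u | M u}, h F = pf_params (th j) l.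
    by move=> l; have [F _ hF] := oth l; exists F.
  by exists F.
pose F j := sval (cid (exF j)); pose hF j := svalP (cid (exF j)).
pose S j (t : I) : set ('I_n -> U) :=
  fun x => sat2 (pf_formula (th j)) x (fun l => sval (F j l t)).
have [|j hj] := generic_meet_pigeonhole UG (S := S) _ (generic_meet_array UG cons Gcol).
  have [chi hchi] := ex_closure (V1 := 'I_n) (V2 := I -> {u | M u}) (Conj
    (rename phi (fun z => match z with inl i => inl i | inr l => inr (A l) end))
    (Conjs (List.map (fun j => Not (rename (pf_formula (th j))
       (fun z => match z with inl i => inl i | inr l => inr (F j l) end))) (enum 'I_(size bs))))).
  have chiE v : sat chi v <-> exists x : 'I_n -> U, sat2 phi x (fun l => v (A l)) /\
      forall j, ~ sat2 (pf_formula (th j)) x (fun l => v (F j l)).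
    have E r (psi : formula L ('I_n + 'I_r)) (B : 'I_r -> I -> {u | M u}) x :
        sat (rename psi (fun z => match z with inl i => inl i | inr l => inr (B l) end)) (sumv x v) =
        sat2 psi x (fun l => v (B l)).
      by rewrite sat_rename /sat2; congr sat; apply/funext => -[].
    rewrite hchi; split=> -[x].
      rewrite sat_Conj sat_Conjs_map E => -[h1 h2]; exists x; split=> // j.
      by rewrite -E; exact: h2.
    move=> [h1 h2]; exists x; rewrite sat_Conj sat_Conjs_map E; split=> // j.
    by rewrite sat_Not E; exact: h2.
  have nchi : ~ sat chi h.
    move=> /chiE[x [h1 h2]].
    have [q /In_tnth[j <-] hq] := cov x h1.
    apply: (h2 j); move: hq; rewrite /psat; congr sat2.
    by apply/funext => l; rewrite -(hF j).
  have : G (~` [set t | sat chi (fun F => sval (F t))]).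
    by apply: ultraP => /hh.
  move=> H; apply: filterS H => t nt x h1 /=.
  apply: contrapT => nx; apply: nt; apply/chiE; exists x; split=> // j hj.
  by apply: nx; exists j.
have [dep _ [k [d [hd kd]]]] := bth j; apply: dep.
apply: (independence_of_shattering hU); apply: (@finite_shattering _ _ _ _ _ k).
have x0 : M !=set0 by have [[[u Mu]] _] := eM; exists u.
apply: (generic_rows _ hj tM) => [t l|B tB _]; first exact: (svalP (F j l t)).
apply: (dividing_over_extension hU UG x0 satM _ _ hd kd tB); first by move=> t l; exact: (svalP (F j l t)).
move=> V q p Mp; rewrite (_ : pf_params (th j) = h \o F j).
  by move/(ultrapower_limit (F j) q hh hc Mp).
by apply/funext => l; rewrite -(hF j).
Qed.

Theorem proposition4p14 (L : language) (T : theory L) (hT : complete_theory T)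
    (K : Type) (U : structure L) (hU : monster K T U) :
  (dependent_dividing U K -> NTP2 U) /\ (simple_dividing U K -> simple_theory U).
Proof.
split; first exact: dependent_dividing_NTP2 hU.
exact: simple_dividing_simple hU.
Qed.
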